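(* Let $K,L\ge1$, $t>1$, $\lambda_0^k,\lambda_1^l>0$ with $\sum_{k=1}^K\lambda_0^k=\sum_{l=1}^L\lambda_1^l=1$, and $\nu_0^1,\dots,\nu_0^K,\nu_1^1,\dots,\nu_1^L\in\mathcal P_2(\mathbb R^d)$. Let $X^*\in L^2$ with $X^*\sim\mu$ be a solution of $$\inf_{X\in L^2}\Big\{\tfrac12\|X\|_{L^2}^2-t\sum_l\lambda_1^lF_{\nu_1^l}(X)+(t-1)\sum_k\lambda_0^kF_{\nu_0^k}(X)\Big\}.$$ Then for all $Y^l\in L^2$, $Y^l\sim\nu_1^l$, $l=1,\dots,L$, such that $(X^*,Y^l)_\#P$ is an optimal coupling for the (quadratic cost) transport between $\mu$ and $\nu_1^l$, the measure $\mu$ is the unique solution of $$\inf_{\mu'\in\mathcal P_2(\mathbb R^d)}\Big\{t\,\tfrac{W_2^2(\mu',\nu_1)}{2}-(t-1)\sum_{k=1}^K\lambda_0^k\tfrac{W_2^2(\mu',\nu_0^k)}{2}\Big\}\quad\text{with}\quad \nu_1:=\overline Y_\#P,\quad\overline Y:=\sum_{l=1}^L\lambda_1^lY^l.$$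
   Context: $(\Omega,\mathcal F,P)$ is a fixed atomless, separable probability space and $L^2=L^2(\Omega,\mathcal F,P;\mathbb R^d)$. $X\sim\mu$ means $X_\#P=\mu$. $\mathcal P_2(\mathbb R^d)$ is the set of probability measures on $\mathbb R^d$ with finite second moment and $W_2$ is the 2-Wasserstein distance. For $\nu\in\mathcal P_2(\mathbb R^d)$ and $X\in L^2$, $F_\nu(X):=\sup\{\mathbb E[\langle X,Y'\rangle]:Y'\in L^2,\ Y'\sim\nu\}$, which equals the maximum covariance $\sup\{\mathbb E[\langle X',Y'\rangle]: X'\sim X_\#P,\ Y'\sim\nu\}$. *)

(* Defs.v *)
From HB Require Import structures.
From mathcomp Require Import all_boot all_order all_algebra.
From mathcomp Require Import all_classical all_reals all_analysis.
From mathcomp Require Import measurable_realfun.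

Set Implicit Arguments.
Unset Strict Implicit.
Unset Printing Implicit Defensive.

Import Order.TTheory GRing.Theory Num.Theory.

Local Open Scope classical_set_scope.
Local Open Scope ring_scope.
Local Open Scope ereal_scope.

(* R^d as a measurable space: the library's sigma-algebra on tuples is the one
   generated by the coordinates, i.e. the Borel sigma-algebra of R^d. *)
Notation Rd R d := (d.-tuple R).

Section euclidean.
Context {R : realType} {d : nat}.

Definition dot (x y : Rd R d) : R := (\sum_(i < d) tnth x i * tnth y i)%R.

Definition subv (x y : Rd R d) : Rd R d :=
  [tuple (tnth x i - tnth y i)%R | i < d].

Definition sqnorm (x : Rd R d) : R := dot x x.

End euclidean.

(* A [probability] is a set function defined on all subsets, of which only the
   values on measurable sets are meaningful: two of them are the same measure
   when they agree there, not when they are Leibniz-equal. *)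
Definition same_measure disp (T : measurableType disp) (R : realType)
    (mu nu : set T -> \bar R) : Prop :=
  forall A, measurable A -> mu A = nu A.

Section probability_space.
Context {disp : measure_display} {Omega : measurableType disp} {R : realType}.
Variable P : probability Omega R.

Definition atomless : Prop :=
  forall A, measurable A -> 0 < P A ->
    exists B, [/\ measurable B, B `<=` A, 0 < P B & P B < P A].

(* Separability of the measure algebra for the distance P (A symdiff B). *)
Definition separable : Prop :=
  exists D : nat -> set Omega, (forall n, measurable (D n)) /\
    forall (A : set Omega) (e : R), measurable A -> (0 < e)%R ->
      exists n, P ((A `\` D n) `|` (D n `\` A)) < e%:E.

End probability_space.

Section random_vectors.
Context {disp : measure_display} {Omega : measurableType disp} {R : realType}.
Variables (P : probability Omega R) (d : nat).
Implicit Types X Y : {RV P >-> Rd R d}.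

(* [in_L2 X] : X is (a representative of) an element of L^2(P; R^d). *)
Definition in_L2 X : Prop := 'E_P[fun w => sqnorm (X w)] < +oo.

Definition has_law X (mu : probability (Rd R d) R) : Prop :=
  same_measure (distribution P X) mu.

Definition maxcov (nu : probability (Rd R d) R) X : \bar R :=
  ereal_sup [set 'E_P[fun w => dot (X w) (Y w)] |
              Y in [set Y : {RV P >-> Rd R d} | in_L2 Y /\ has_law Y nu]].

Definition rv_pair X Y : Omega -> Rd R d * Rd R d := fun w => (X w, Y w).

Let measurable_rv_pair X Y : measurable_fun setT (rv_pair X Y).
Proof. by apply: measurable_fun_pair. Qed.

HB.instance Definition _ X Y :=
  isMeasurableFun.Build _ _ _ _ (rv_pair X Y) (measurable_rv_pair X Y).

Definition rv_comb (L : nat) (a : 'I_L -> R)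
    (Y : 'I_L -> {RV P >-> Rd R d}) : Omega -> Rd R d :=
  fun w => [tuple (\sum_(l < L) a l * tnth (Y l w) i)%R | i < d].

Let measurable_rv_comb L a (Y : 'I_L -> {RV P >-> Rd R d}) :
  measurable_fun setT (rv_comb a Y).
Proof.
apply/measurable_fun_tnthP => i.
rewrite (_ : _ \o _ = fun w => (\sum_(l < L) a l * tnth (Y l w) i)%R); last first.
  by apply/funext => w /=; rewrite tnth_mktuple.
apply: measurable_sum => l; apply: measurable_funM => //.
by apply: (measurableT_comp (measurable_tnth i)).
Qed.

HB.instance Definition _ L a (Y : 'I_L -> {RV P >-> Rd R d}) :=
  isMeasurableFun.Build _ _ _ _ (rv_comb a Y) (measurable_rv_comb a Y).

End random_vectors.

Section wasserstein.
Context {R : realType} {d : nat}.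
Implicit Types (mu nu : probability (Rd R d) R).
Implicit Types (gamma : probability (Rd R d * Rd R d)%type R).

Definition P2 : set (probability (Rd R d) R) :=
  [set mu | \int[mu]_x (sqnorm x)%:E < +oo].

Definition coupling mu nu gamma : Prop :=
  same_measure (pushforward gamma fst) mu /\
  same_measure (pushforward gamma snd) nu.

Definition transport_cost gamma : \bar R :=
  \int[gamma]_z (sqnorm (subv z.1 z.2))%:E.

Definition W2 mu nu : \bar R :=
  (ereal_inf [set transport_cost gamma | gamma in coupling mu nu]) `^ 2^-1.

Definition optimal_coupling mu nu gamma : Prop :=
  coupling mu nu gamma /\
  forall gamma', coupling mu nu gamma' ->
    transport_cost gamma <= transport_cost gamma'.

End wasserstein.

Definition minimizer (T : Type) (R : realType) (A : set T) (f : T -> \bar R)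
    (x : T) : Prop :=
  A x /\ forall y, A y -> f x <= f y.

Section objectives.
Context {disp : measure_display} {Omega : measurableType disp} {R : realType}.
Variables (P : probability Omega R) (d K L : nat) (t : R).
Variables (lam0 : 'I_K -> R) (lam1 : 'I_L -> R).
Variables (nu0 : 'I_K -> probability (Rd R d) R).

Definition L2_objective (nu1 : 'I_L -> probability (Rd R d) R)
    (X : {RV P >-> Rd R d}) : \bar R :=
  (2^-1)%:E * 'E_P[fun w => sqnorm (X w)]
  - t%:E * (\sum_(l < L) (lam1 l)%:E * maxcov (nu1 l) X)
  + (t - 1)%:E * (\sum_(k < K) (lam0 k)%:E * maxcov (nu0 k) X).

Definition extrapolation_objective (nu1 mu : probability (Rd R d) R) : \bar R :=
  t%:E * ((2^-1)%:E * W2 mu nu1 ^+ 2)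
  - (t - 1)%:E * (\sum_(k < K) (lam0 k)%:E * ((2^-1)%:E * W2 mu (nu0 k) ^+ 2)).

End objectives.

(* Main.v *)
(** Write F_nu for the maximum covariance, nubar for the law of
    Ybar = \sum_l lam1 l * Y l, and J for the L^2 objective in which each
    F_{nu1 l}(X) is replaced by the linear functional E<X, Y l>.  Then J dominates
    the objective and agrees with it at Xstar, so Xstar minimizes J, and J is
    strongly convex.  Up to a constant, the extrapolation objective at mu' is the
    infimum of J over the X with law mu': this needs that on an atomless space
    every coupling of the law of a given variable (here Ybar) can be realised,
    up to an arbitrarily small loss of covariance, by a second variable with
    exactly the prescribed law.  Hence mu is a minimizer; and for any other
    minimizer mu', variables of law mu' that nearly minimize J converge to Xstar
    in L^2 by strong convexity, so mu' = mu.

    The realisation is obtained by discretising the given variable on a fine grid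
    and splitting each of its level sets along a binary tree with the masses
    prescribed by the coupling. *)

Require Import Defs.
From HB Require Import structures.
From mathcomp Require Import all_boot all_order all_algebra.
From mathcomp Require Import all_classical all_reals all_analysis.
From mathcomp Require Import measurable_realfun ring lra.

Set Implicit Arguments.
Unset Strict Implicit.
Unset Printing Implicit Defensive.

Import Order.TTheory GRing.Theory Num.Theory.

Local Open Scope classical_set_scope.
Local Open Scope ring_scope.

(** * Splitting in atomless spaces *)

Section atomless_splitting.
Context {disp : measure_display} {Omega : measurableType disp} {R : realType}.
Variable P : probability Omega R.
Hypothesis P_atomless : atomless P.

Let p (A : set Omega) : R := fine (P A).

Let pE A : measurable A -> P A = (p A)%:E.
Proof. by move=> mA; rewrite fineK// fin_num_measure. Qed.

Let p_ge0 A : 0 <= p A.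
Proof. by rewrite fine_ge0. Qed.

Let p0 : p set0 = 0.
Proof. by rewrite /p measure0. Qed.

Let p_le A B : measurable A -> measurable B -> A `<=` B -> p A <= p B.
Proof. by move=> mA mB AB; rewrite -lee_fin -!pE// le_measure ?inE. Qed.

Let pD A B : measurable A -> measurable B -> B `<=` A -> p (A `\` B) = p A - p B.
Proof.
move=> mA mB BA; apply: EFin_inj; rewrite EFinB -!pE//; last exact: measurableD.
by rewrite measureD ?setIidr// -ge0_fin_numE// fin_num_measure.
Qed.

Let pU A B : measurable A -> measurable B -> [disjoint A & B] ->
  p (A `|` B) = p A + p B.
Proof.
move=> mA mB AB; apply: EFin_inj; rewrite EFinD -!pE//; last exact: measurableU.
by rewrite measureU//; apply/eqP.
Qed.

(** Atomlessness cuts a set of positive mass into two parts of positive mass, one of which has at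
    most half of it. Iterating [n] times leaves mass at most [2 ^- n]. *)
Lemma atomless_small (A : set Omega) (e : R) :
  measurable A -> (0 < P A)%E -> 0 < e ->
  exists B, [/\ measurable B, B `<=` A, (0 < P B)%E & (P B < e%:E)%E].
Proof.
move=> mA A0 e0.
have halve (C : set Omega) : measurable C -> 0 < p C ->
    exists D, [/\ measurable D, D `<=` C, 0 < p D & p D <= p C / 2].
  move=> mC C0; have [|B [mB BC B0 BC']] := P_atomless mC; first by rewrite pE.
  move: B0 BC'; rewrite !pE// !lte_fin => B0 BC'.
  have [h|h] := leP (p B) (p C / 2); first by exists B.
  exists (C `\` B); rewrite pD//; split; [|exact: subDsetl|lra|lra].
  exact: measurableD.
have iter_halve n : exists D, [/\ measurable D, D `<=` A, 0 < p D & p D <= 2 ^- n].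
  elim: n => [|n [D [mD DA D0 Dn]]].
    exists A; split=> //; first by rewrite -lte_fin -pE.
    by rewrite expr0 invr1 -lee_fin -pE// probability_le1.
  have [D' [mD' D'D D'0 D'n]] := halve _ mD D0.
  exists D'; split=> //; first exact: subset_trans D'D DA.
  rewrite exprS invfM; lra.
have [n _ /(_ n (leqnn n))] := near_infty_natSinv_expn_lt (PosNum e0).
rewrite /= mul1r => ne.
have [D [mD DA D0 Dn]] := iter_halve n; exists D; split=> //.
  by rewrite pE// lte_fin.
by rewrite pE// lte_fin (le_lt_trans Dn).
Qed.

(* Greedy exhaustion: at each step add a set of at least half the largest
   admissible mass. *)
Lemma atomless_split (A : set Omega) (c : R) :
  measurable A -> 0 <= c -> (c%:E <= P A)%E ->
  exists B, [/\ measurable B, B `<=` A & P B = c%:E].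
Proof.
move=> mA c0; rewrite pE// lee_fin => cA.
pose adm (B D : set Omega) :=
  [/\ measurable D, D `<=` A `\` B & p B + p D <= c].
(* The premises on [B] sit under the existential, so that [choice] yields a function defined on
   every set. *)
have greedy B : exists D, measurable B -> p B <= c ->
    adm B D /\ forall D', adm B D' -> p D' <= 2 * p D.
  have [[mB Bc]|nB] := pselect (measurable B /\ p B <= c); last first.
    by exists set0 => mB Bc; exfalso; apply: nB.
  pose E := [set p D | D in adm B].
  have adm0 : adm B set0.
    by split; [exact: measurable0|exact: sub0set|rewrite p0 addr0].
  have supE : has_sup E.
    split; first by exists (p set0), set0.
    by exists c => _ [D [_ _ h] <-]; apply: le_trans h; rewrite lerDr.
  have ubE D' : adm B D' -> p D' <= sup E.
    by move=> aD'; apply: ub_le_sup; [case: supE|exists D'].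
  (* If no admissible set has positive mass, the empty set is already half-maximal; otherwise some
     admissible set exceeds half the supremum. *)
  have [s0|s0] := leP (sup E) 0.
    exists set0 => _ _; split=> // D' /ubE h.
    by rewrite p0; lra.
  have /(sup_adherent) /(_ supE) [_ [D aD <-] hD] : 0 < sup E / 2 by lra.
  by exists D => _ _; split=> // D' /ubE h; lra.
have [next nextP] := choice greedy.
pose F n := iter n (fun B => B `|` next B) set0.
have Fgood n : [/\ measurable (F n), F n `<=` A & p (F n) <= c].
  elim: n => [|n [mF FA Fc]].
    by split; [exact: measurable0|exact: sub0set|rewrite p0].
  have [[mD DA Dc] _] := nextP _ mF Fc.
  split; first exact: measurableU.
    by move=> w [/FA//|/DA[]].
  rewrite /= pU//; apply/disj_setPS => w [Fw /DA[]//].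
have mF n : measurable (F n) by case: (Fgood n).
have FS n : p (F n.+1) = p (F n) + p (next (F n)).
  have [_ FA Fc] := Fgood n; have [[mD DA Dc] _] := nextP _ (mF n) Fc.
  by rewrite /= pU//; apply/disj_setPS => w [Fw /DA[]//].
pose B := \bigcup_n F n.
have mB : measurable B by exact: bigcup_measurable.
have BA : B `<=` A by move=> w [n _]; case: (Fgood n) => _ + _; apply.
have FB n : F n `<=` B by exact: bigcup_sup.
have Fmono : {homo F : n m / (n <= m)%N >-> (n <= m)%O}.
  apply: homo_leq; [by move=> x; exact: lexx|by move=> y x z; exact: le_trans|].
  by move=> n; rewrite subsetEset => w; left.
have Bc : p B <= c.
  rewrite -lee_fin -pE//.
  have FBcvg := nondecreasing_cvg_mu (mu := P) mF mB Fmono.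
  rewrite -(cvg_lim _ FBcvg)//; apply: lime_le; first by apply: cvgP FBcvg.
  by apply: nearW => n /=; rewrite pE// lee_fin; case: (Fgood n).
exists B; split=> //; rewrite pE//; congr EFin; apply/eqP.
rewrite eq_le Bc /= leNgt; apply/negP => Bc'.
have mAB : measurable (A `\` B) by exact: measurableD.
(* If mass were missing, a set [D] of mass below [c - p B] would be admissible at every step. Each
   step would then gain at least [p D / 2], and [p (F n)] would pass [c]. *)
have [||D] := atomless_small (e := c - p B) mAB.
- by rewrite pE// pD// lte_fin; lra.
- by lra.
move=> [mD DAB]; rewrite !pE// !lte_fin => D0 Dc.
have Dnext n : p D <= 2 * p (next (F n)).
  have [_ FA Fc] := Fgood n; have [_] := nextP _ (mF n) Fc; apply.
  split=> //; first by move=> w /DAB[Aw Bw]; split=> // /FB.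
  by have := p_le (mF n) mB (@FB n); lra.
have Fn n : n%:R * (p D / 2) <= p (F n).
  elim: n => [|n IH]; first by rewrite mul0r.
  by rewrite FS -(natr1 n) mulrDl mul1r; have := Dnext n; lra.
have [n] : exists n : nat, c < n%:R * (p D / 2).
  exists (Num.truncn (c / (p D / 2))).+1.
  rewrite -ltr_pdivrMr; last lra.
  exact: truncnS_gt.
by have := Fn n; case: (Fgood n); lra.
Qed.

End atomless_splitting.

(** * Coding points of R^d by bits *)

(** Uniqueness of finite measures on an intersection-stable generator, applied to the images of [m1]
    restricted to [D1] and [m2] restricted to [D2]. The whole space belongs to [G] and serves as the
    exhausting sequence. *)
Lemma eq_preimage_measure (R : realType) (d1 d2 d3 : measure_display)
    (U1 : measurableType d1) (U2 : measurableType d2) (T : measurableType d3)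
    (m1 : probability U1 R) (m2 : probability U2 R)
    (f1 : U1 -> T) (f2 : U2 -> T) (D1 : set U1) (D2 : set U2)
    (G : set (set T)) :
  measurable_fun setT f1 -> measurable_fun setT f2 ->
  measurable D1 -> measurable D2 ->
  measurable = <<s G >> -> setI_closed G -> G setT ->
  (forall C, G C -> m1 (D1 `&` f1 @^-1` C) = m2 (D2 `&` f2 @^-1` C)) ->
  forall C, measurable C -> m1 (D1 `&` f1 @^-1` C) = m2 (D2 `&` f2 @^-1` C).
Proof.
move=> mf1 mf2 mD1 mD2 mG GI GT m12 C mC.
rewrite (setIC D1) (setIC D2).
apply: (@measure_unique _ R T G (fun=> setT) mG GI (fun=> GT) _
  (pushforward (mrestr m1 mD1) f1) (pushforward (mrestr m2 mD2) f2)) => //.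
- by rewrite bigcup_const//; exists 0%N.
- by move=> B /m12; rewrite (setIC D1) (setIC D2).
- move=> _ /=; rewrite (le_lt_trans _ (ltry 1))// probability_le1//.
  by rewrite preimage_setT setTI.
Qed.

(** Only events asking finitely many bits to be [true] are listed: concatenating lists shows
    stability under intersection, and they still generate the product sigma-algebra. *)
Definition bit_cylinders : set (set (nat -> bool)) :=
  [set [set b : nat -> bool | all b s] | s in [set: seq nat]].

Notation bits := (g_sigma_algebraType bit_cylinders).

Lemma bit_cylinders_setI_closed : setI_closed bit_cylinders.
Proof.
move=> _ _ [s _ <-] [s' _ <-]; exists (s ++ s') => //.
by apply/seteqP; split=> b /=; rewrite all_cat => /andP.
Qed.

Lemma bit_cylindersT : bit_cylinders setT.
Proof. by exists [::] => //; apply/seteqP. Qed.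

Lemma measurable_bit (n : nat) : measurable_fun setT (fun b : bits => b n).
Proof.
apply: (measurable_fun_bool true); rewrite setTI.
apply: sub_sigma_algebra; exists [:: n] => //.
by apply/seteqP; split=> b /=; rewrite andbT.
Qed.

Lemma measurable_fun_bits (disp : measure_display) (T : measurableType disp)
    (f : T -> bits) :
  (forall n, measurable_fun setT (fun x => f x n)) -> measurable_fun setT f.
Proof.
move=> mf.
apply: (@measurability _ _ _ bits setT f bit_cylinders erefl) => _ [_ [s _ <-] <-].
rewrite setTI; elim: s => [|n s IH].
  by rewrite (_ : _ @^-1` _ = setT)//; apply/seteqP.
rewrite (_ : _ @^-1` _ = (fun x => f x n) @^-1` [set true] `&`
                         f @^-1` [set b : nat -> bool | all b s]).
  by apply: measurableI => //; rewrite -[X in measurable X]setTI; exact: mf.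
by apply/seteqP; split=> x /= => [/andP|[-> ->]].
Qed.

Section coding.
Context {R : realType} {d : nat}.

Let halfspace (n : nat) : option ('I_d * rat) := unpickle n.

(* Rational half-spaces separate points: [tnth y i] is the infimum of the
   rationals [q] with [tnth y i <= q]. *)
Definition code (y : Rd R d) : bits :=
  fun n => if halfspace n is Some (i, q) then tnth y i <= ratr q else false.

(** Indices of another coordinate, or with a false bit, contribute [+oo] and leave the infimum
    unchanged. A countable infimum followed by [fine] is total and measurable on all bit sequences,
    codes or not. *)
Definition decode (b : bits) : Rd R d :=
  [tuple fine (einfs (fun n => if halfspace n is Some (j, q) then
       if (j == i) && b n then (ratr q)%:E else +oo%E else +oo%E) 0) | i < d].

Lemma codeK : cancel code decode.
Proof.
move=> y; apply: eq_from_tnth => i; rewrite tnth_mktuple.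
set u := (u in einfs u); suff -> : einfs u 0 = (tnth y i)%:E by [].
apply/eqP; rewrite eq_le; apply/andP; split.
  apply/lee_addgt0Pr => e e0.
  have [q /=] : exists q : rat, ratr q \in `]tnth y i, tnth y i + e[.
    by apply: rat_in_itvoo; rewrite ltrDl.
  rewrite in_itv /= => /andP[yq qe].
  apply: (@le_trans _ _ (ratr q)%:E); last by rewrite -EFinD lee_fin ltW.
  apply: ereal_inf_lbound; exists (pickle (i, q)) => //.
  by rewrite /u /code /halfspace pickleK eqxx /= ltW.
apply: le_ereal_inf_tmp => _ [n _ <-]; rewrite /u /code.
case: (halfspace n) => [[j q]|]; last exact: leey.
by case: eqP => [->|_] /=; [case: ifP; rewrite ?lee_fin ?leey|exact: leey].
Qed.

Lemma measurable_code : measurable_fun setT code.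
Proof.
apply: measurable_fun_bits => n; rewrite /code.
case: (halfspace n) => [[i q]|]; last exact: measurable_cst.
by apply: measurable_fun_ler; [exact: measurable_tnth|exact: measurable_cst].
Qed.

Lemma measurable_decode : measurable_fun setT decode.
Proof.
apply/measurable_fun_tnthP => i.
rewrite (_ : _ \o _ = fun b : bits => fine (einfs (fun n =>
    if halfspace n is Some (j, q) then
    if (j == i) && b n then (ratr q)%:E else +oo%E else +oo%E) 0)); last first.
  by apply/funext => b /=; rewrite tnth_mktuple.
apply: measurableT_comp => //; apply: (measurable_fun_einfs _ 0) => n.
case: (halfspace n) => [[j q]|]; last exact: measurable_cst.
case: (j == i) => /=; last exact: measurable_cst.
apply: measurable_fun_ifT; [exact: measurable_bit|exact: measurable_cst|].
exact: measurable_cst.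
Qed.

End coding.

(** * Transfer of laws to an atomless space *)

Section transfer.
Context {disp disp' : measure_display} {Omega : measurableType disp}
  {U : measurableType disp'} {R : realType} {d : nat}.
Variables (P : probability Omega R) (m : probability U R).
Hypothesis P_atomless : atomless P.
Variables (f : U -> bits) (mf : measurable_fun setT f).
Variables (A : set Omega) (D : set U).
Hypotheses (mA : measurable A) (mD : measurable D) (PA : P A = m D).

(** The latest bit comes first, so reading one more bit is a cons and addresses can be treated by
    induction on lists. *)
Let prefix (b : nat -> bool) n := rev (mkseq b n).

Let prefixS b n : prefix b n.+1 = b n :: prefix b n.
Proof. by rewrite /prefix mkseqS rev_rcons. Qed.

Let size_prefix b n : size (prefix b n) = n.
Proof. by rewrite size_rev size_mkseq. Qed.

Let all_prefix b n s : all (fun k => (k < n)%N) s ->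
  all b s = all (nth false (rev (prefix b n))) s.
Proof.
by move=> /allP sn; apply: eq_in_all => k /sn kn; rewrite revK nth_mkseq.
Qed.

Let measurable_prefix d' (T : measurableType d') (g : T -> bits) w :
  measurable_fun setT g -> measurable [set x | prefix (g x) (size w) = w].
Proof.
move=> mg; elim: w => [|b w IH] /=.
  by rewrite (_ : [set _ | _] = setT)//; apply/seteqP.
rewrite (_ : [set _ | _] = ((fun x => g x (size w)) @^-1` [set b]) `&`
    [set x | prefix (g x) (size w) = w]); last first.
  by apply/seteqP; split=> x /=; rewrite prefixS => -[-> ->].
apply: measurableI => //; rewrite -[X in measurable X]setTI.
have /= := measurableT_comp (measurable_bit (size w)) mg; exact.
Qed.

Let cell w := D `&` [set u | prefix (f u) (size w) = w].

Let mcell w : measurable (cell w).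
Proof. by apply: measurableI => //; exact: measurable_prefix. Qed.

(** The form suits [choice]: measurability of [E] is unconditional, so every node of the tree is
    measurable before anything is known about its mass. *)
Let split_exists (Bc : set Omega * R) : exists E, measurable E /\
  (measurable Bc.1 -> 0 <= Bc.2 -> (Bc.2%:E <= P Bc.1)%E ->
   E `<=` Bc.1 /\ P E = Bc.2%:E).
Proof.
have [[mB c0 cB]|nB] :=
  pselect [/\ measurable Bc.1, 0 <= Bc.2 & (Bc.2%:E <= P Bc.1)%E].
  by have [E [mE EB PE]] := atomless_split P_atomless mB c0 cB; exists E.
by exists set0; split=> // mB c0 cB; exfalso; exact: nB.
Qed.

Let spl := projT1 (choice split_exists).

Let piece w B := spl (B, fine (m (cell (true :: w)))).

Let mpiece w B : measurable (piece w B).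
Proof.
by have [] := projT2 (choice split_exists) (B, fine (m (cell (true :: w)))).
Qed.

(* [A] is split along the binary tree so that the piece at address [w] has the
   [m]-mass of [cell w]. *)
Fixpoint mass_tree (w : seq bool) : set Omega :=
  if w is b :: w' then
    let B := mass_tree w' in
    if b then B `&` piece w' B else B `\` piece w' B
  else A.

Let mtree w : measurable (mass_tree w).
Proof.
by elim: w => [|[] w IH] //=; [exact: measurableI|exact: measurableD].
Qed.

Let cellS w : cell w = cell (true :: w) `|` cell (false :: w).
Proof.
apply/seteqP; split=> u; rewrite /cell /= prefixS.
  by move=> [Du <-]; rewrite size_prefix; case: (f u _); [left|right].
by move=> [] [Du [_ ->]].
Qed.

Let cell_disj w : cell (true :: w) `&` cell (false :: w) = set0.
Proof.
by apply/disj_set2P/disj_setPS => u; rewrite /cell /= prefixS => -[[_ [->]] _ [_ []]].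
Qed.

(** By induction on the address: the mass asked for the [true] child is at most that of [cell w],
    hence available in [mass_tree w]. The [false] child gets the remainder, as does the
    corresponding cell. *)
Let ptree w : P (mass_tree w) = m (cell w).
Proof.
elim: w => [|b w IH].
  by rewrite PA /cell /= (_ : [set _ | _] = setT) ?setIT//; apply/seteqP.
have mE : m (cell w) = (m (cell (true :: w)) + m (cell (false :: w)))%E.
  by rewrite cellS measureU// cell_disj.
have [_ /= []] := projT2 (choice split_exists)
  (mass_tree w, fine (m (cell (true :: w)))).
- exact: mtree.
- exact: fine_ge0.
- by rewrite IH fineK ?fin_num_measure// mE leeDl.
rewrite -/spl -/(piece w (mass_tree w)) => pw pE.
have Ptrue : P (mass_tree (true :: w)) = m (cell (true :: w)).
  by rewrite /= setIidr// pE fineK// fin_num_measure.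
case: b => //.
have : P (mass_tree w) =
    (P (mass_tree (false :: w)) + P (mass_tree (true :: w)))%E.
  exact: measureDI (mtree w) (mpiece w _).
rewrite IH mE Ptrue addeC => /(congr1 (fun z => z - m (cell (true :: w)))%E).
by rewrite !addeK ?fin_num_measure// => ->.
Qed.

(* [tree_code x n] is the address, last bit first, of the piece of depth [n]
   that contains [x]; the next bit is decided by the split of that piece. *)
Let tree_code (x : Omega) : nat -> seq bool := fix pre n :=
  if n is k.+1 then `[< piece (pre k) (mass_tree (pre k)) x >] :: pre k
  else [::].

Let g (x : Omega) : bits :=
  fun n => `[< piece (tree_code x n) (mass_tree (tree_code x n)) x >].

Let tree_codeE x n : tree_code x n = prefix (g x) n.
Proof. by elim: n => // n IH; rewrite prefixS -IH. Qed.

(** The next bit of [g x] is by construction membership in the set that splits the current node, so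
    descending the tree reads off the bits of [g x]. *)
Let tree_cell w : mass_tree w = A `&` [set x | prefix (g x) (size w) = w].
Proof.
elim: w => [|b w IH] /=.
  by rewrite (_ : [set _ | _] = setT) ?setIT//; apply/seteqP.
apply/seteqP; split=> x.
- have key : mass_tree w x -> b = g x (size w) ->
      (A `&` [set x | prefix (g x) (size w).+1 = b :: w]) x.
    by rewrite {1}IH => -[Ax /= xw] ->; split=> //=; rewrite prefixS xw.
  have gE : mass_tree w x -> g x (size w) = `[< piece w (mass_tree w) x >].
    by rewrite {1}IH => -[Ax /= xw]; rewrite /g tree_codeE xw.
  case: b key => key -[wx px]; apply: key => //; rewrite gE//; apply/esym.
    exact/asboolP.
  exact/asboolPn.
- move=> [Ax /=]; rewrite prefixS => -[gb xw].
  have wx : mass_tree w x by rewrite IH.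
  move: gb; rewrite /g tree_codeE xw; case: b => [/asboolP|/asboolPn]; by split.
Qed.

Let mg : measurable_fun setT g.
Proof.
(* Measurability is needed on all of [Omega], while [tree_cell] speaks only of [A]. Bit [n] is
   therefore expressed through the countably many possible prefixes of length [n]. *)
suff mpre w : measurable [set x | prefix (g x) (size w) = w].
  apply: measurable_fun_bits => n; apply: (measurable_fun_bool true).
  rewrite setTI (_ : _ @^-1` _ = \bigcup_w
     ([set x | prefix (g x) (size w) = w] `&`
      [set x | size w = n /\ piece w (mass_tree w) x])); last first.
    apply/seteqP; split=> x /=.
      move=> /asboolP; rewrite tree_codeE => h; exists (prefix (g x) n) => //=.
      by rewrite size_prefix.
    by move=> [w _ [/= xw [<- pw]]]; apply/asboolP; rewrite tree_codeE xw.
  apply: countable_bigcupT_measurable => // w; apply: measurableI => //.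
  have [<-|wn] := eqVneq (size w) n.
    rewrite (_ : [set _ | _] = piece w (mass_tree w))//.
    by apply/seteqP; split=> x /=; tauto.
  rewrite (_ : [set _ | _] = set0)//; apply/seteqP; split=> x //= [/eqP].
  by rewrite (negPf wn).
elim: w => [|b w IH] /=.
  by rewrite (_ : [set _ | _] = setT)//; apply/seteqP.
rewrite (_ : [set _ | _] = [set x | prefix (g x) (size w) = w] `&`
    (if b then piece w (mass_tree w) else ~` piece w (mass_tree w))).
  by apply: measurableI => //; case: b => //; exact: measurableC.
apply/seteqP; split=> x /=; rewrite prefixS.
  move=> [gb xw]; split=> //; move: gb.
  by rewrite /g tree_codeE xw; case: b => [/asboolP|/asboolPn].
move=> [xw h]; rewrite xw; congr (_ :: _); rewrite /g tree_codeE xw.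
by case: b h => h; [apply/asboolP|apply/asboolPn].
Qed.

(** Induction on the number [k] of levels left below [w]. At depth [N] the address decides every bit
    tested by [s], so both sides are the mass of the node or [0]; higher up, both sides add over the
    two children. *)
Let bits_eq s N : all (fun k => (k < N)%N) s ->
  forall k w, (size w + k = N)%N ->
  P (mass_tree w `&` [set x | all (g x) s]) =
  m (cell w `&` [set u | all (f u) s]).
Proof.
move=> sN; elim=> [|k IH] w; last first.
  move=> wk.
  have mall d' (T : measurableType d') (h : T -> bits) : measurable_fun setT h ->
      measurable [set x | all (h x) s].
    move=> mh; rewrite (_ : [set x | _] =
      setT `&` h @^-1` ([set b : nat -> bool | all b s] : set bits)); last first.
      by rewrite setTI.
    apply: mh => //.
    by apply: sub_sigma_algebra; exists s.
  have treeS : mass_tree w = mass_tree (true :: w) `|` mass_tree (false :: w).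
    by rewrite /= setUIDK.
  set X := [set x | all (g x) s]; set Y := [set u | all (f u) s].
  have -> : P (mass_tree w `&` X) =
      (P (mass_tree (true :: w) `&` X) + P (mass_tree (false :: w) `&` X))%E.
    rewrite treeS setIUl; apply: measureU.
    - by apply: measurableI => //; exact: mall.
    - by apply: measurableI => //; exact: mall.
    - by apply/disj_set2P/disj_setPS => x [[[_ px] _] [[_ npx] _]].
  have -> : m (cell w `&` Y) =
      (m (cell (true :: w) `&` Y) + m (cell (false :: w) `&` Y))%E.
    rewrite cellS setIUl; apply: measureU.
    - by apply: measurableI => //; exact: mall.
    - by apply: measurableI => //; exact: mall.
    - by rewrite setIACA cell_disj set0I.
  by rewrite !IH//= addSn -addnS.
rewrite addn0 => wN.
rewrite (_ : mass_tree w `&` _ =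
    if all (nth false (rev w)) s then mass_tree w else set0).
  rewrite (_ : cell w `&` _ =
      if all (nth false (rev w)) s then cell w else set0).
    by case: ifP => _; rewrite ?measure0// ptree.
  apply/seteqP; split=> u; rewrite /cell /= wN.
    by move=> [[Du fw]]; rewrite (all_prefix _ sN) fw => ->.
  by case: ifP => // sw [Du fw]; split=> //; rewrite (all_prefix _ sN) fw.
rewrite tree_cell.
apply/seteqP; split=> u; rewrite /= wN.
  by move=> [[Du fw]]; rewrite (all_prefix _ sN) fw => ->.
by case: ifP => // sw [Du fw]; split=> //; rewrite (all_prefix _ sN) fw.
Qed.

Lemma atomless_bits : exists g : Omega -> bits, measurable_fun setT g /\
  forall C, measurable C -> P (A `&` g @^-1` C) = m (D `&` f @^-1` C).
Proof.
exists g; split=> //.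
apply: (@eq_preimage_measure _ _ _ _ _ _ bits _ _ _ _ _ _ bit_cylinders) => //.
- exact: bit_cylinders_setI_closed.
- exact: bit_cylindersT.
move=> _ [s _ <-].
(* The depth is one more than the largest tested index, so that it exceeds all of them. *)
have sN : all (fun k => (k < (\max_(k <- s) k).+1)%N) s.
  by apply/allP => k ks; rewrite ltnS; apply: leq_bigmax_seq.
have := bits_eq sN (w := [::]) (erefl _).
rewrite /cell /= (_ : [set _ | [::] = [::]] = setT) ?setIT//.
by apply/seteqP.
Qed.

End transfer.

(** * Square-integrable random vectors *)

Section square_integrable.
Context {disp : measure_display} {T : measurableType disp} {R : realType}
  {d : nat}.
Variable m : probability T R.
Implicit Types f g h : T -> Rd R d.

Definition square_integrable f := measurable_fun setT f /\
  m.-integrable setT (EFin \o (fun w => sqnorm (f w))).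

Definition inner f g : R := \int[m]_w dot (f w) (g w).

Lemma dotC (x y : Rd R d) : dot x y = dot y x.
Proof. by apply: eq_bigr => i _; rewrite mulrC. Qed.

Lemma sqnorm_ge0 (x : Rd R d) : 0 <= sqnorm x.
Proof. by apply: sumr_ge0 => i _; rewrite -expr2 sqr_ge0. Qed.

Lemma dot_le_sqnorm (x y : Rd R d) : `|dot x y| <= sqnorm x + sqnorm y.
Proof.
rewrite /sqnorm /dot -big_split /= (le_trans (ler_norm_sum _ _ _))//.
apply: ler_sum => i _; rewrite ler_norml.
by set a := tnth x i; set b := tnth y i; apply/andP; split; nra.
Qed.

Lemma sqnorm_subv (x y : Rd R d) :
  sqnorm (subv x y) = sqnorm x + sqnorm y - 2 * dot x y.
Proof.
rewrite /sqnorm /dot mulr_sumr -sumrN -!big_split /=.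
by apply: eq_bigr => i _; rewrite tnth_mktuple; ring.
Qed.

(** The factor [3] is [1 + 2], from the crude bound [dot_le_sqnorm]; the estimate serves as an
    integrable majorant. *)
Lemma sqnorm_subv_le (x y : Rd R d) :
  sqnorm (subv x y) <= 3 * (sqnorm x + sqnorm y).
Proof.
by rewrite sqnorm_subv; have := dot_le_sqnorm x y; rewrite ler_norml => /andP[]; lra.
Qed.

Lemma measurable_dot f g : measurable_fun setT f -> measurable_fun setT g ->
  measurable_fun setT (fun w => dot (f w) (g w)).
Proof.
move=> mf mg; apply: measurable_sum => i; apply: measurable_funM.
  by have := measurableT_comp (measurable_tnth i) mf; exact.
by have := measurableT_comp (measurable_tnth i) mg; exact.
Qed.

Lemma measurable_subv f g : measurable_fun setT f -> measurable_fun setT g ->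
  measurable_fun setT (fun w => subv (f w) (g w)).
Proof.
move=> mf mg; apply/measurable_fun_tnthP => i.
rewrite (_ : _ \o _ = fun w => tnth (f w) i - tnth (g w) i); last first.
  by apply/funext => w /=; rewrite tnth_mktuple.
apply: measurable_funB.
  by have := measurableT_comp (measurable_tnth i) mf; exact.
by have := measurableT_comp (measurable_tnth i) mg; exact.
Qed.

Lemma le_integrableR (u v : T -> R) : measurable_fun setT u ->
  (forall w, `|u w| <= v w) -> m.-integrable setT (EFin \o v) ->
  m.-integrable setT (EFin \o u).
Proof.
move=> mu uv iv; apply: (le_integrable measurableT) iv; first exact/measurable_EFinP.
by move=> w _ /=; rewrite lee_fin (le_trans (uv w))// ler_norm.
Qed.

Lemma square_integrableP f : measurable_fun setT f ->
  (\int[m]_w (sqnorm (f w))%:E < +oo)%E -> square_integrable f.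
Proof.
move=> mf foo; split=> //; apply/integrableP; split.
  by apply/measurable_EFinP; exact: measurable_dot.
rewrite (eq_integral (fun w => (sqnorm (f w))%:E))// => w _.
by rewrite gee0_abs// lee_fin sqnorm_ge0.
Qed.

Lemma integrable_dot f g : square_integrable f -> square_integrable g ->
  m.-integrable setT (EFin \o (fun w => dot (f w) (g w))).
Proof.
move=> [mf sf] [mg sg].
apply: (@le_integrableR _ (fun w => sqnorm (f w) + sqnorm (g w))).
- exact: measurable_dot.
- by move=> w; exact: dot_le_sqnorm.
- by have := integrableD measurableT sf sg; exact.
Qed.

Lemma integral_dotE f g : square_integrable f -> square_integrable g ->
  (\int[m]_w (dot (f w) (g w))%:E)%E = (inner f g)%:E.
Proof.
by move=> sf sg; rewrite fineK//; apply: integrable_fin_num => //; exact: integrable_dot.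
Qed.

Lemma square_integrable_subv f g : square_integrable f -> square_integrable g ->
  square_integrable (fun w => subv (f w) (g w)).
Proof.
move=> [mf sf] [mg sg]; have mfg := measurable_subv mf mg; split=> //.
apply: (@le_integrableR _ (fun w => 3 * (sqnorm (f w) + sqnorm (g w)))).
- exact: measurable_dot.
- by move=> w; rewrite ger0_norm ?sqnorm_ge0// sqnorm_subv_le.
- by have := integrableZl measurableT 3 (integrableD measurableT sf sg); exact.
Qed.

Lemma innerC f g : inner f g = inner g f.
Proof. by apply: eq_Rintegral => w _; rewrite dotC. Qed.

Lemma inner_ge0 f : 0 <= inner f f.
Proof. by apply: Rintegral_ge0 => w _; exact: sqnorm_ge0. Qed.

(** Linearity of the integral. The combination [f] is given through its dot products, the form
    supplied by [dot_rv_comb]. *)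
Lemma inner_sum (I : finType) (a : I -> R) (F : I -> T -> Rd R d) f g :
  (forall w x, dot (f w) x = \sum_i a i * dot (F i w) x) ->
  (forall i, square_integrable (F i)) -> square_integrable g ->
  inner f g = \sum_i a i * inner (F i) g.
Proof.
move=> fE sF sg; rewrite /inner.
under eq_Rintegral => w _ do rewrite fE.
transitivity (fine (\int[m]_w (\sum_(i in I) (a i * dot (F i w) (g w))%:E))%E).
  by congr fine; apply: eq_integral => w _; rewrite sumEFin.
have iF i : m.-integrable setT (fun w => (a i * dot (F i w) (g w))%:E).
  have := integrableZl measurableT (a i) (integrable_dot (sF i) sg); exact.
rewrite integral_sum//; apply: EFin_inj; rewrite fineK; last first.
  by apply/sum_fin_numP => i _ _; exact: integrable_fin_num.
rewrite -sumEFin; apply: eq_bigr => i _.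
under eq_integral do rewrite EFinM.
rewrite integralZl//; last exact: integrable_dot.
by rewrite integral_dotE// EFinM.
Qed.

End square_integrable.

(** * Integrals of variables with the same law *)

Section same_law.
Context {R : realType} {d1 d2 d3 : measure_display}
  {T1 : measurableType d1} {T2 : measurableType d2} {T : measurableType d3}.
Variables (m1 : probability T1 R) (m2 : probability T2 R).
Variables (f1 : T1 -> T) (f2 : T2 -> T).
Hypotheses (mf1 : measurable_fun setT f1) (mf2 : measurable_fun setT f2).
Hypothesis same_law : same_measure (pushforward m1 f1) (pushforward m2 f2).
Variables (h : T -> R) (mh : measurable_fun setT h).

Lemma integral_same_law : (forall x, 0 <= h x) ->
  (\int[m1]_x (h (f1 x))%:E = \int[m2]_x (h (f2 x))%:E)%E.
Proof.
move=> h0.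
have mEh : measurable_fun setT (EFin \o h) by exact/measurable_EFinP.
have h0' : {in [set: T], forall y, (0 <= (EFin \o h) y)%E}.
  by move=> y _; rewrite lee_fin.
have := ge0_integral_pushforward mf1 m1 measurableT mEh h0'.
have := ge0_integral_pushforward mf2 m2 measurableT mEh h0'.
rewrite !preimage_setT => <- <-.
by apply: eq_measure_integral => A mA _; exact: same_law.
Qed.

Hypothesis ih : m2.-integrable setT (EFin \o h \o f2).

Lemma integrable_same_law : m1.-integrable setT (EFin \o h \o f1).
Proof.
have mEh : measurable_fun setT (EFin \o h) by exact/measurable_EFinP.
apply/integrableP; split; first exact: measurableT_comp.
have /integrableP[_] := ih; congr (_ < _)%E.
have mah : measurable_fun setT (abse \o (EFin \o h))
  by apply: measurableT_comp.
have h0 : {in [set: T], forall y, (0 <= (abse \o (EFin \o h)) y)%E}.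
  by move=> y _; exact: abse_ge0.
have := ge0_integral_pushforward mf1 m1 measurableT mah h0.
have := ge0_integral_pushforward mf2 m2 measurableT mah h0.
rewrite !preimage_setT => <- <-.
by apply: eq_measure_integral => A mA _; apply/esym; exact: same_law.
Qed.

Lemma Rintegral_same_law :
  \int[m1]_x (h (f1 x)) = \int[m2]_x (h (f2 x)).
Proof.
have mEh : measurable_fun setT (EFin \o h) by exact/measurable_EFinP.
have := integral_pushforward mf1 mEh integrable_same_law measurableT.
have := integral_pushforward mf2 mEh ih measurableT.
rewrite !preimage_setT /Rintegral => <- <-; congr fine.
by apply: eq_measure_integral => A mA _; exact: same_law.
Qed.

End same_law.

(** * Approximate realisation of a coupling with a given first variable *)

Section near_coupling.
Context {disp : measure_display} {Omega : measurableType disp} {R : realType}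
  {d : nat}.
Variable P : probability Omega R.
Hypothesis P_atomless : atomless P.
Variable gamma : probability (Rd R d * Rd R d)%type R.

Section discrete_part.
Variables (X : Omega -> Rd R d) (mX : measurable_fun setT X).
Hypothesis X_law : same_measure (pushforward P X) (pushforward gamma fst).
Variables (r : Rd R d -> nat) (mr : forall i, measurable [set x | r x = i]).

Let A i := X @^-1` [set x | r x = i].
Let D i : set (Rd R d * Rd R d) := fst @^-1` [set x | r x = i].

Let mA i : measurable (A i).
Proof. by rewrite -[X in measurable X]setTI; exact: mX. Qed.

Let mD i : measurable (D i).
Proof. by rewrite -[X in measurable X]setTI; exact: measurable_fst. Qed.

(** By [X_law] the level sets [A i] and [D i] have equal mass, so [atomless_bits] copies the coded
    second component of [gamma] from [D i] to [A i]. [Y] decodes the copy of the level it is in. *)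
Lemma atomless_coupling_fibers : exists Y : Omega -> Rd R d,
  measurable_fun setT Y /\ forall i C, measurable C ->
    P ([set w | r (X w) = i] `&` Y @^-1` C) =
    gamma ([set z | r z.1 = i] `&` snd @^-1` C).
Proof.
have mcode : measurable_fun setT (fun z : Rd R d * Rd R d => code z.2).
  have := measurableT_comp (@measurable_code R d)
    (@measurable_snd _ _ (Rd R d) (Rd R d)); exact.
have AD i : P (A i) = gamma (D i) by exact: X_law.
have [g gP] := choice (fun i =>
  atomless_bits P_atomless mcode (mA i) (mD i) (AD i)).
have mdg i : measurable_fun setT (fun w => decode (g i w) : Rd R d).
  have := measurableT_comp (@measurable_decode R d) (gP i).1; exact.
exists (fun w => decode (g (r (X w)) w)); split=> [_ C mC|i C mC].
  rewrite setTI (_ : _ @^-1` _ = \bigcup_i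
    (A i `&` (fun w => decode (g i w)) @^-1` C)); last first.
    apply/seteqP; split=> w /=; first by exists (r (X w)).
    by move=> [i _ [/= <-]].
  apply: bigcup_measurable => i _; apply: measurableI => //.
  by rewrite -[X in measurable X]setTI; exact: mdg.
have mdC : measurable (@decode R d @^-1` C).
  by rewrite -[X in measurable X]setTI; exact: measurable_decode.
have := (gP i).2 _ mdC; congr (_ = _).
  by congr (P _); apply/seteqP; split=> w /= [<-].
by congr (gamma _); apply/seteqP; split=> z /= [<-]; rewrite codeK.
Qed.

Lemma atomless_coupling_discrete (rep : nat -> Rd R d) :
  exists Y : Omega -> Rd R d, [/\ measurable_fun setT Y,
    same_measure (pushforward P Y) (pushforward gamma snd) &
    same_measure (pushforward P (fun w => (rep (r (X w)), Y w)))
                 (pushforward gamma (fun z => (rep (r z.1), z.2)))].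
Proof.
have [Y [mY YP]] := atomless_coupling_fibers; exists Y.
have joint : same_measure (pushforward P (fun w => (rep (r (X w)), Y w)))
    (pushforward gamma (fun z => (rep (r z.1), z.2))).
  move=> C mC; rewrite /pushforward.
  have mYC i : measurable (Y @^-1` xsection C (rep i)).
    by rewrite -[X in measurable X]setTI; apply: mY => //; exact: measurable_xsection.
  have msC i : measurable (snd @^-1` xsection C (rep i) : set (Rd R d * Rd R d)).
    rewrite -[X in measurable X]setTI.
    by apply: (@measurable_snd _ _ (Rd R d) (Rd R d)) => //; exact: measurable_xsection.
  (* On level [i] the first component is the constant [rep i], so [C] is seen only through its
     section there, and the fibrewise identity can be summed over [i]. *)
  rewrite (_ : _ @^-1` C = \bigcup_i (A i `&` Y @^-1` xsection C (rep i))); last first.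
    apply/seteqP; split=> w /=.
      by move=> Cw; exists (r (X w)) => //; split=> //=; rewrite /xsection /= inE.
    by move=> [i _ [/= <-]]; rewrite /xsection /= inE.
  rewrite (_ : _ @^-1` C = \bigcup_i (D i `&` snd @^-1` xsection C (rep i))); last first.
    apply/seteqP; split=> w /=.
      by move=> Cw; exists (r w.1) => //; split=> //=; rewrite /xsection /= inE.
    by move=> [i _ [/= <-]]; rewrite /xsection /= inE.
  rewrite !measure_bigcup//.
  - apply: eq_eseriesr => i _; apply: YP; exact: measurable_xsection.
  - by move=> i _; exact: measurableI.
  - apply/trivIsetP => i j _ _ ij.
    apply/disj_set2P/disj_setPS => w /= [[ri _] [rj _]].
    by move: ij; rewrite -ri -rj eqxx.
  - by move=> i _; exact: measurableI.
  - apply/trivIsetP => i j _ _ ij.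
    apply/disj_set2P/disj_setPS => w /= [[ri _] [rj _]].
    by move: ij; rewrite -ri -rj eqxx.
split=> // C mC.
have := joint _ (measurableX (@measurableT _ (Rd R d)) mC).
by rewrite /pushforward; congr (_ = _); [congr (P _)|congr (gamma _)];
  apply/seteqP; split=> z //= [].
Qed.

End discrete_part.

(** The cube of side [e] of the lattice grid that contains [x], its integer multi-index being packed
    into a natural number. *)
Let grid_index (e : R) (x : Rd R d) : nat :=
  pickle [tuple Num.floor (tnth x i / e) | i < d].

(** The lower corner of cube [n]; numbers coding no cube are sent to the origin. *)
Let grid_point (e : R) (n : nat) : Rd R d :=
  if unpickle n is Some z then [tuple (tnth (z : d.-tuple int) i)%:~R * e | i < d]
  else [tuple 0 | i < d].

Let grid_approx (e : R) x i : 0 < e ->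
  `|tnth x i - tnth (grid_point e (grid_index e x)) i| <= e.
Proof.
move=> e0; rewrite /grid_point /grid_index pickleK !tnth_mktuple.
have /andP[] := floor_itv (tnth x i / e).
rewrite ler_pdivlMr// ltr_pdivrMr// intrD mulrDl mul1r ler_norml => h1 h2.
by apply/andP; split; lra.
Qed.

Let measurable_grid (e : R) i : 0 < e -> measurable [set x | grid_index e x = i].
Proof.
move=> e0; case: (pselect (exists x, grid_index e x = i)) => [[x0 <-]|ni]; last first.
  rewrite (_ : [set _ | _] = set0)//.
  by apply/seteqP; split=> x // xi; apply: ni; exists x.
set z := fun j => Num.floor (tnth x0 j / e).
rewrite (_ : [set _ | _] = \bigcap_(j in [set: 'I_d])
  ((fun x : Rd R d => tnth x j) @^-1` `[(z j)%:~R * e, (z j + 1)%:~R * e[));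
  last first.
  apply/seteqP; split=> x /=.
    move=> /(pcan_inj pickleK) xx0 j _ /=.
    have /(congr1 (fun t => tnth t j)) := xx0; rewrite !tnth_mktuple => /eqP.
    rewrite floor_eq => /andP[h1 h2]; rewrite in_itv /=.
    by rewrite -ler_pdivlMr// -ltr_pdivrMr// h1.
  move=> h; congr pickle; apply: eq_from_tnth => j; rewrite !tnth_mktuple.
  apply/eqP; rewrite floor_eq; have := h j I; rewrite /= in_itv /=.
  by rewrite -ler_pdivlMr// -ltr_pdivrMr//.
apply: fin_bigcap_measurable => // j _; rewrite -[X in measurable X]setTI.
by apply: measurable_tnth => //; exact: measurable_itv.
Qed.

Let dot_approx (e : R) (x y z : Rd R d) : 0 < e ->
  (forall i, `|tnth x i - tnth z i| <= e) ->
  `|dot x y - dot z y| <= e * (d%:R + sqnorm y).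
Proof.
move=> e0 xz; rewrite /dot -sumrB (le_trans (ler_norm_sum _ _ _))//.
have -> : d%:R = \sum_(i < d) (1 : R) by rewrite sumr_const card_ord.
rewrite /sqnorm /dot -big_split mulr_sumr; apply: ler_sum => i _.
rewrite -mulrBl normrM ler_pM//.
(* The bound used is [|a| <= 1 + a^2]; summed over coordinates it gives [d + sqnorm y]. *)
set a := tnth y i.
have h1 := sqr_ge0 (a - 1); have h2 := sqr_ge0 (a + 1); have h3 := sqr_ge0 a.
rewrite ler_norml; apply/andP; split; rewrite ?expr2 /= in h1 h2 h3 *; lra.
Qed.

(** The pointwise bound [dot_approx] is integrated. As [h] is merely measurable, integrability of
    its product with [g] comes from writing it as a difference of two integrable functions. *)
Let inner_approx (e : R) disp' (T : measurableType disp') (m : probability T R)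
    (f g h : T -> Rd R d) : 0 < e -> measurable_fun setT h ->
  square_integrable m f -> square_integrable m g ->
  (forall w i, `|tnth (f w) i - tnth (h w) i| <= e) ->
  m.-integrable setT (EFin \o (fun w => dot (h w) (g w))) /\
  `|inner m f g - inner m h g| <= e * (d%:R + inner m g g).
Proof.
move=> e0 mh sf sg fh.
have ifg := integrable_dot sf sg.
pose v w := e * (d%:R + sqnorm (g w)).
have iv : m.-integrable setT (EFin \o v).
  have i1 : m.-integrable setT (EFin \o (fun _ : T => d%:R : R)).
    exact: finite_measure_integrable_cst.
  have := integrableZl measurableT e (integrableD measurableT i1 sg.2); exact.
have dv w : `|dot (f w) (g w) - dot (h w) (g w)| <= v w by exact: dot_approx.
have [[mf _] [mg _]] := (sf, sg).
have idiff :
    m.-integrable setT (EFin \o (fun w => dot (f w) (g w) - dot (h w) (g w))).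
  by apply: (le_integrableR _ dv) => //; apply: measurable_funB; exact: measurable_dot.
have ihg : m.-integrable setT (EFin \o (fun w => dot (h w) (g w))).
  apply: eq_integrable (integrableB measurableT ifg idiff) => //.
  by move=> w _ /=; rewrite -EFinB; congr EFin; ring.
split=> //; rewrite /inner -RintegralB//.
apply: (le_trans (le_normr_Rintegral measurableT idiff)).
have -> : e * (d%:R + \int[m]_w dot (g w) (g w)) = \int[m]_w v w.
  have i1 : m.-integrable setT (EFin \o (fun _ : T => d%:R : R)).
    exact: finite_measure_integrable_cst.
  rewrite /v RintegralZl//; last first.
    have := integrableD measurableT i1 sg.2; exact.
  rewrite RintegralD//; last exact: sg.2.
  congr (_ * (_ + _)); rewrite Rintegral_cst//.
  transitivity (d%:R * fine 1%E : R); first by rewrite mulr1.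
  by congr (_ * fine _); exact/esym/probability_setT.
by apply: le_Rintegral => //; have := integrable_abse idiff; exact.
Qed.

(** Once first components are rounded to the grid, the two pairs have the same law and the same
    covariance. The only loss is the rounding error, made once under [P] and once under [gamma]. *)
Lemma exists_rv_near_coupling (X : Omega -> Rd R d) (e : R) :
  same_measure (pushforward P X) (pushforward gamma fst) ->
  square_integrable P X -> square_integrable gamma snd -> 0 < e ->
  exists Y : Omega -> Rd R d, [/\ square_integrable P Y,
    same_measure (pushforward P Y) (pushforward gamma snd) &
    inner gamma fst snd - e <= inner P X Y].
Proof.
move=> X_law sX s2 e0.
have mfst := @measurable_fst _ _ (Rd R d) (Rd R d).
have msnd := @measurable_snd _ _ (Rd R d) (Rd R d).
have s1 : square_integrable gamma fst.
  split=> //; have /= := @integrable_same_law R _ _ _ _ _ (Rd R d) gamma P fst X.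
  apply => //; first exact: sX.1.
  - by move=> C mC; apply/esym; exact: X_law.
  - exact: measurable_dot.
  - exact: sX.2.
pose M : R := d%:R + inner gamma snd snd.
have M0 : 0 <= M by rewrite addr_ge0// inner_ge0.
(* Each rounding costs at most [dl * M], and [2 * dl * M = e * M / (M + 1) <= e]; the [+ 1] keeps
   the denominator positive when [M = 0]. *)
pose dl := e / (2 * (M + 1)).
have dl0 : 0 < dl by rewrite divr_gt0//; lra.
have [Y [mY Y_law joint]] := atomless_coupling_discrete sX.1 X_law
  (fun i => @measurable_grid dl i dl0) (grid_point dl).
have sY : square_integrable P Y.
  split=> //; have /= := @integrable_same_law R _ _ _ _ _ (Rd R d) P gamma Y snd.
  apply => //; [exact: measurable_dot|exact: s2.2].
exists Y; split=> //.
have mz d' (T : measurableType d') (f : T -> Rd R d) : measurable_fun setT f ->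
    measurable_fun setT (fun w => grid_point dl (grid_index dl (f w))).
  move=> mf; have mgi : measurable_fun setT (fun w => grid_index dl (f w)).
    move=> _ C _; rewrite setTI.
    rewrite (_ : _ @^-1` _ =
        \bigcup_(i in C) (f @^-1` [set x | grid_index dl x = i])).
      apply: bigcup_measurable => i _; rewrite -[X in measurable X]setTI.
      by apply: mf => //; exact: measurable_grid.
    apply/seteqP; split=> w /=; last by move=> [i Ci /= ->].
    by move=> Cw; exists (grid_index dl (f w)).
  by apply: measurableT_comp mgi.
have [ihP hP] := inner_approx dl0 (mz _ _ _ sX.1) sX sY
  (fun w i => grid_approx (X w) i dl0).
have [ihg hg] := inner_approx dl0 (mz _ _ _ mfst) s1 s2
  (fun w i => grid_approx w.1 i dl0).
have eqz : inner P (fun w => grid_point dl (grid_index dl (X w))) Y =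
    inner gamma (fun z => grid_point dl (grid_index dl z.1)) snd.
  have /= := @Rintegral_same_law R _ _ _ _ _ (Rd R d * Rd R d)%type P gamma
    (fun w => (grid_point dl (grid_index dl (X w)), Y w))
    (fun z => (grid_point dl (grid_index dl z.1), z.2))
    _ _ joint (fun z => dot z.1 z.2).
  apply => //.
  - by apply: measurable_fun_pair => //; exact: mz sX.1.
  - by apply: measurable_fun_pair => //; exact: mz.
  - exact: measurable_dot.
have eqY : inner P Y Y = inner gamma snd snd.
  have /= := @Rintegral_same_law R _ _ _ _ _ (Rd R d) P gamma Y snd
    mY msnd Y_law (@sqnorm R d).
  apply => //; [exact: measurable_dot|exact: s2.2].
have eM : 2 * (dl * M) <= e.
  have -> : 2 * (dl * M) = e * (M / (M + 1)) by rewrite /dl; field; lra.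
  by apply: ler_piMr; [exact: ltW|rewrite ler_pdivrMr; lra].
move: hP hg; rewrite eqz eqY -/M !ler_norml => /andP[h1 h2] /andP[h3 h4].
by lra.
Qed.

End near_coupling.

(** * Maximal correlation and the Wasserstein distance *)

Section max_correlation.
Context {R : realType} {d : nat}.
Implicit Types (mu nu : probability (Rd R d) R).
Implicit Types (gamma : probability (Rd R d * Rd R d)%type R).

Definition moment2 mu : R := \int[mu]_x sqnorm x.

(** The maximum covariance as a real number depending on laws only. For laws in [P2] the set is
    nonempty and bounded above, so [sup] is genuine. *)
Definition maxcorr mu nu : R :=
  sup [set inner gamma fst snd | gamma in coupling mu nu].

Lemma P2_square_integrable mu : P2 mu -> square_integrable mu id.
Proof. by move=> Pmu; apply: square_integrableP => //; exact: measurable_id. Qed.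

Lemma square_integrable_law (disp : measure_display) (T : measurableType disp)
    (m : probability T R) (f : T -> Rd R d) mu :
  P2 mu -> measurable_fun setT f -> same_measure (pushforward m f) mu ->
  square_integrable m f /\ inner m f f = moment2 mu.
Proof.
move=> /P2_square_integrable [mid sid] mf flaw.
have msq : measurable_fun setT (@sqnorm R d) by exact: measurable_dot.
split; first split=> //.
  have := @integrable_same_law R _ _ _ _ _ (Rd R d) m mu f id mf mid flaw.
  by move=> /(_ _ msq sid); exact.
have := @Rintegral_same_law R _ _ _ _ _ (Rd R d) m mu f id mf mid flaw.
by move=> /(_ _ msq sid); exact.
Qed.

Let mfst := @measurable_fst _ _ (Rd R d) (Rd R d).
Let msnd := @measurable_snd _ _ (Rd R d) (Rd R d).

Section coupling_moments.
Variables (mu nu : probability (Rd R d) R)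
  (gamma : probability (Rd R d * Rd R d)%type R).
Hypotheses (mu2 : P2 mu) (nu2 : P2 nu) (cg : coupling mu nu gamma).

Lemma coupling_square_integrable :
  square_integrable gamma fst /\ square_integrable gamma snd.
Proof.
by split; [have [] := square_integrable_law mu2 mfst cg.1
          |have [] := square_integrable_law nu2 msnd cg.2].
Qed.

(** Expand the square: the marginals fix both second moments, so minimal cost means maximal
    covariance. *)
Lemma transport_costE : transport_cost gamma =
  (moment2 mu + moment2 nu - 2 * inner gamma fst snd)%:E.
Proof.
have [s1 e1] := square_integrable_law mu2 mfst cg.1.
have [s2 e2] := square_integrable_law nu2 msnd cg.2.
have i12 := integrableD measurableT s1.2 s2.2.
have i3 := integrableZl measurableT 2 (integrable_dot s1 s2).
rewrite /transport_cost.
under eq_integral do rewrite sqnorm_subv EFinB EFinD EFinM.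
rewrite integralB//; last first.
rewrite integralD//; [|exact: s1.2|exact: s2.2].
rewrite integralZl//; last exact: integrable_dot.
by rewrite (integral_dotE s1 s2) (integral_dotE s1 s1) (integral_dotE s2 s2) e1 e2.
Qed.

Lemma inner_coupling_le : 2 * inner gamma fst snd <= moment2 mu + moment2 nu.
Proof.
have := transport_costE; rewrite -subr_ge0 -lee_fin => <-.
by apply: integral_ge0 => z _; rewrite lee_fin sqnorm_ge0.
Qed.

End coupling_moments.

Lemma coupling_product mu nu : coupling mu nu (mu \x nu)%E.
Proof.
split=> C mC; rewrite /pushforward.
  rewrite (_ : _ @^-1` C = C `*` setT); last by apply/seteqP; split=> z //= [].
  apply: (eq_trans (product_measure1E mu nu mC measurableT)).
  by rewrite -[RHS]mule1; congr (_ * _)%E; exact: probability_setT.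
rewrite (_ : _ @^-1` C = setT `*` C); last by apply/seteqP; split=> z //= [].
apply: (eq_trans (product_measure1E mu nu measurableT mC)).
by rewrite -[RHS]mul1e; congr (_ * _)%E; exact: probability_setT.
Qed.

Lemma has_sup_maxcorr mu nu : P2 mu -> P2 nu ->
  has_sup [set inner gamma fst snd | gamma in coupling mu nu].
Proof.
move=> mu2 nu2; split.
  by eexists; exists (mu \x nu)%E => //; exact: coupling_product.
exists ((moment2 mu + moment2 nu) / 2) => _ [gamma cg <-].
by rewrite ler_pdivlMr// mulrC; exact: inner_coupling_le.
Qed.

Lemma le_maxcorr mu nu gamma : P2 mu -> P2 nu -> coupling mu nu gamma ->
  inner gamma fst snd <= maxcorr mu nu.
Proof.
by move=> mu2 nu2 cg; apply: ub_le_sup; [case: (has_sup_maxcorr mu2 nu2)|exists gamma].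
Qed.

Lemma maxcorr_adherent mu nu (e : R) : P2 mu -> P2 nu -> 0 < e ->
  exists2 gamma, coupling mu nu gamma & maxcorr mu nu - e < inner gamma fst snd.
Proof.
move=> mu2 nu2 e0.
by have [_ [gamma cg <-] h] := sup_adherent e0 (has_sup_maxcorr mu2 nu2); exists gamma.
Qed.

Lemma maxcorrC mu nu : P2 mu -> P2 nu -> maxcorr mu nu = maxcorr nu mu.
Proof.
suff sub (m n : probability (Rd R d) R) : P2 m -> P2 n ->
    [set inner gamma fst snd | gamma in coupling m n] `<=`
    [set inner gamma fst snd | gamma in coupling n m].
  by move=> mu2 nu2; rewrite /maxcorr; congr sup; apply/seteqP; split; exact: sub.
move=> m2 n2 _ [gamma cg <-].
pose swap (z : Rd R d * Rd R d) := (z.2, z.1).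
have mswap : measurable_fun setT swap by exact: measurable_fun_pair.
pose sw : {mfun (Rd R d * Rd R d)%type >-> (Rd R d * Rd R d)%type} :=
  HB.pack swap (isMeasurableFun.Build _ _ _ _ _ mswap).
exists (distribution gamma sw).
  by split=> C mC; [exact: cg.2|exact: cg.1].
have [s1 s2] := coupling_square_integrable m2 n2 cg.
rewrite innerC.
apply: (@Rintegral_same_law R _ _ _ _ _ (Rd R d * Rd R d)%type
  (distribution gamma sw) gamma id sw _ _ _ (fun z => dot z.2 z.1)) => //.
- exact: measurable_dot.
- exact: integrable_dot.
Qed.

Lemma W2_sqr mu nu : P2 mu -> P2 nu ->
  (W2 mu nu ^+ 2 = (moment2 mu + moment2 nu - 2 * maxcorr mu nu)%:E)%E.
Proof.
move=> mu2 nu2; set v := (X in X%:E).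
(* [W2] is a square root, so squaring it back needs a nonnegative radicand. *)
have v0 : 0 <= v.
  rewrite subr_ge0 mulrC -ler_pdivlMr//; apply: ge_sup.
    by case: (has_sup_maxcorr mu2 nu2).
  by move=> _ [gamma cg <-]; rewrite ler_pdivlMr// mulrC; exact: inner_coupling_le.
rewrite /W2 (_ : ereal_inf _ = v%:E).
  by rewrite poweR_EFin -EFin_expe powR12_sqrt// sqr_sqrtr.
apply/eqP; rewrite eq_le; apply/andP; split.
  apply/lee_addgt0Pr => e e0.
  have [|gamma cg he] := @maxcorr_adherent mu nu (e / 2) mu2 nu2.
    by rewrite divr_gt0.
  apply: ge_ereal_inf; exists (transport_cost gamma); first by exists gamma.
  by rewrite (transport_costE mu2 nu2 cg) -EFinD lee_fin /v; lra.
apply: le_ereal_inf_tmp => _ [gamma cg <-].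
rewrite (transport_costE mu2 nu2 cg) lee_fin /v.
by have := le_maxcorr mu2 nu2 cg; lra.
Qed.

End max_correlation.

(** * Maximum covariance in terms of random vectors *)

Section random_vectors.
Context {disp : measure_display} {Omega : measurableType disp} {R : realType}
  {d : nat}.
Variable P : probability Omega R.
Hypothesis P_atomless : atomless P.
Implicit Types (X Y : {RV P >-> Rd R d}) (mu nu : probability (Rd R d) R).

Definition rv_of (f : Omega -> Rd R d) (mf : measurable_fun setT f) :
    {RV P >-> Rd R d} :=
  HB.pack f (isMeasurableFun.Build _ _ _ _ f mf).

Lemma in_L2P X : in_L2 X <-> square_integrable P X.
Proof.
rewrite /in_L2 unlock; split=> [Xoo|[_ /integrableP[_]]].
  exact: square_integrableP.
rewrite (eq_integral (fun w => (sqnorm (X w))%:E))// => w _.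
by rewrite gee0_abs// lee_fin sqnorm_ge0.
Qed.

Lemma expectation_sqnorm X : in_L2 X ->
  ('E_P[fun w => sqnorm (X w)] = (inner P X X)%:E)%E.
Proof. by move=> /in_L2P sX; rewrite unlock (integral_dotE sX sX). Qed.

Lemma expectation_dot X Y : in_L2 X -> in_L2 Y ->
  ('E_P[fun w => dot (X w) (Y w)] = (inner P X Y)%:E)%E.
Proof. by move=> /in_L2P sX /in_L2P sY; rewrite unlock (integral_dotE sX sY). Qed.

Lemma P2_law X mu : has_law X mu -> in_L2 X -> P2 mu.
Proof.
move=> law; rewrite /in_L2 unlock /P2 /=; congr (_ < _)%E.
apply: (@integral_same_law R _ _ _ _ _ (Rd R d) P mu X id) => //.
- exact: measurable_dot.
- exact: sqnorm_ge0.
Qed.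

Lemma in_L2_law X mu : has_law X mu -> P2 mu ->
  in_L2 X /\ inner P X X = moment2 mu.
Proof.
by move=> law mu2; rewrite in_L2P; exact: square_integrable_law.
Qed.

Lemma coupling_pair X Y mu nu : has_law X mu -> has_law Y nu ->
  coupling mu nu (distribution P (rv_pair X Y)).
Proof. by move=> Xmu Ynu; split=> C mC; [exact: Xmu|exact: Ynu]. Qed.

Lemma inner_pair X Y : in_L2 X -> in_L2 Y ->
  inner (distribution P (rv_pair X Y)) fst snd = inner P X Y.
Proof.
move=> /in_L2P sX /in_L2P sY.
apply: (@Rintegral_same_law R _ _ _ _ _ (Rd R d * Rd R d)%type
  (distribution P (rv_pair X Y)) P id (rv_pair X Y) _ _ _ (fun z => dot z.1 z.2)) => //.
- exact: measurable_dot.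
- exact: integrable_dot.
Qed.

Lemma inner_le_maxcorr X Y mu nu : has_law X mu -> has_law Y nu ->
  in_L2 X -> in_L2 Y -> inner P X Y <= maxcorr mu nu.
Proof.
move=> Xmu Ynu sX sY; rewrite -inner_pair//; apply: le_maxcorr.
- exact: P2_law Xmu sX.
- exact: P2_law Ynu sY.
- exact: coupling_pair.
Qed.

Lemma exists_rv_near_maxcorr X mu nu (e : R) : has_law X mu -> in_L2 X ->
  P2 nu -> 0 < e ->
  exists Y, [/\ in_L2 Y, has_law Y nu & maxcorr mu nu - e < inner P X Y].
Proof.
move=> Xmu sX nu2 e0; have mu2 := P2_law Xmu sX.
(* Half of [e] is spent on choosing a nearly optimal coupling, half on realising it with first
   variable [X]. *)
have e20 : 0 < e / 2 by rewrite divr_gt0.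
have [gamma cg hg] := maxcorr_adherent mu2 nu2 e20.
have [s1 s2] := coupling_square_integrable mu2 nu2 cg.
have X_law : same_measure (pushforward P X) (pushforward gamma fst).
  by move=> C mC; rewrite [RHS]cg.1//; exact: Xmu.
have [f [sf f_law hf]] := exists_rv_near_coupling P_atomless X_law
  ((in_L2P _).1 sX) s2 e20.
exists (rv_of sf.1); split; first exact/in_L2P.
- by move=> C mC; rewrite -[RHS]cg.2//; exact: f_law.
- by lra.
Qed.

(** Every admissible [Y] forms a coupling with [X]; conversely atomlessness lets [X] nearly realise
    any coupling. Hence the functional depends on the law of [X] alone. *)
Lemma maxcov_maxcorr X mu nu : has_law X mu -> in_L2 X -> P2 nu ->
  maxcov nu X = (maxcorr mu nu)%:E.
Proof.
move=> Xmu sX nu2; have mu2 := P2_law Xmu sX.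
apply/eqP; rewrite eq_le; apply/andP; split.
  apply: ge_ereal_sup => _ [Y [sY Ynu] <-].
  by rewrite expectation_dot// lee_fin; exact: inner_le_maxcorr.
apply/lee_addgt0Pr => e e0.
have [Y [sY Ynu hY]] := exists_rv_near_maxcorr Xmu sX nu2 e0.
rewrite -leeBlDr//; apply: le_ereal_sup_tmp.
exists ('E_P[fun w => dot (X w) (Y w)])%E; first by exists Y.
by rewrite expectation_dot// -EFinB lee_fin ltW.
Qed.

End random_vectors.

(** * Convergence in mean square of variables with a common law *)

(** The sets tested are finite intersections of rational half-spaces, or empty. They determine a law
    because [decode] recovers a point measurably from its code. *)
Lemma same_measure_code (R : realType) (d : nat)
    (m1 m2 : probability (Rd R d) R) :
  (forall s, m1 [set x | all (code x) s] = m2 [set x | all (code x) s]) ->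
  same_measure m1 m2.
Proof.
move=> m12 A mA.
have mcode := @measurable_code R d.
have eq_code : forall C : set bits, measurable C ->
    m1 (setT `&` code @^-1` C) = m2 (setT `&` code @^-1` C).
  apply: (@eq_preimage_measure _ _ _ _ _ _ bits _ _ _ _ _ _ bit_cylinders) => //.
  - exact: bit_cylinders_setI_closed.
  - exact: bit_cylindersT.
  by move=> _ [s _ <-]; rewrite !setTI; exact: m12.
have mdA : measurable (@decode R d @^-1` A).
  by rewrite -[X in measurable X]setTI; exact: measurable_decode.
have := eq_code _ mdA; rewrite !setTI.
by rewrite (_ : code @^-1` _ = A)//; apply/seteqP; split=> x /=; rewrite codeK.
Qed.

Section law_limit.
Context {R : realType} {d : nat}.

Let shift (e : R) (x : Rd R d) : Rd R d := [tuple tnth x i - e | i < d].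

(** The intersection of half-spaces coded by [s], each bound [q] being relaxed to [q + e]. *)
Let box s e := [set x | all (code (shift e x)) s].

Let measurable_box s e : measurable (box s e).
Proof.
have mshift : measurable_fun setT (shift e).
  apply/measurable_fun_tnthP => i.
  rewrite (_ : _ \o _ = fun x => tnth x i - e); last first.
    by apply/funext => x /=; rewrite tnth_mktuple.
  by apply: measurable_funB; [exact: measurable_tnth|exact: measurable_cst].
have /= := measurableT_comp (@measurable_code R d) mshift.
move=> /(_ measurableT [set b : nat -> bool | all b s]); rewrite setTI; apply.
by apply: sub_sigma_algebra; exists s.
Qed.

Let box0 s : box s 0 = [set x | all (code x) s].
Proof.
apply/seteqP; split=> x; rewrite /box /= (_ : shift 0 x = x)//;
  by apply: eq_from_tnth => i; rewrite tnth_mktuple subr0.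
Qed.

Let code_shift_le (x y : Rd R d) (e : R) n :
  (forall i, tnth x i - e <= tnth y i) -> code y n -> code (shift e x) n.
Proof.
move=> xy; rewrite /code; case: (unpickle n) => // -[i q].
by rewrite tnth_mktuple; exact: le_trans.
Qed.

(** Let [eta] tend to [0] at fixed [e], then [e] along [1 / (n + 1)]: half-spaces being closed, the
    relaxed boxes decrease to [box s 0], and [m2] is continuous from above. *)
Let le_box (m1 m2 : probability (Rd R d) R) s :
  (forall e eta : R, 0 < e -> 0 < eta ->
    (m1 (box s 0) <= m2 (box s e) + eta%:E)%E) ->
  (m1 (box s 0) <= m2 (box s 0))%E.
Proof.
move=> h; pose F (n : nat) := box s n.+1%:R^-1.
have h' n : (m1 (box s 0) <= m2 (F n))%E.
  by apply/lee_addgt0Pr => eta eta0; apply: h; rewrite ?invr_gt0.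
have FE : \bigcap_n F n = box s 0.
  rewrite box0; apply/seteqP; split=> x.
    move=> Fx; apply/allP => n ns.
    have Fn k : code (shift k.+1%:R^-1 x) n by have /allP /(_ n ns) := Fx k I.
    move: Fn; rewrite /code; case: (unpickle n) => [[i q]|]; last by move=> /(_ 0%N).
    move=> Fn; apply/ler_addgt0Pr => e e0.
    have [k _ /(_ k (leqnn k)) /= ke] := near_infty_natSinv_lt (PosNum e0).
    have := Fn k; rewrite tnth_mktuple lerBlDr => /le_trans; apply.
    by rewrite lerD2l ltW.
  move=> xs k _; apply/allP => n /(allP xs).
  by apply: code_shift_le => i; rewrite lerBlDr lerDl invr_ge0.
have mF n : measurable (F n) by exact: measurable_box.
have mono : {homo F : n m / (n <= m)%N >-> (m <= n)%O}.
  move=> k l kl; rewrite subsetEset => x /allP xl; apply/allP => n /xl.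
  rewrite /code; case: (unpickle n) => // -[i q]; rewrite !tnth_mktuple.
  by apply: le_trans; rewrite lerD2l lerN2 lef_pV2 ?posrE// ler_nat.
have F0oo : (m2 (F 0%N) < +oo)%E.
  by rewrite (le_lt_trans _ (ltry 1))// probability_le1.
have cvgF := nonincreasing_cvg_mu (mu := m2) F0oo mF
  (bigcapT_measurable mF) mono.
rewrite FE in cvgF; rewrite -(cvg_lim _ cvgF)//.
by apply: lime_ge; [exact: cvgP cvgF|apply: nearW => n; exact: h'].
Qed.

(** Where [f] is in the box and [g] misses the relaxed one, some coordinate moves by more than [e].
    By Markov's inequality the squared distance reaches [e ^+ 2] with probability at most [eta]. *)
Let box_approx (disp : measure_display) (T : measurableType disp)
    (P : probability T R) (f g : T -> Rd R d) s (e eta : R) :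
  square_integrable P f -> square_integrable P g -> 0 < e ->
  inner P (fun w => subv (f w) (g w)) (fun w => subv (f w) (g w)) <=
    e ^+ 2 * eta ->
  (P (f @^-1` box s 0) <= P (g @^-1` box s e) + eta%:E)%E.
Proof.
move=> sf sg e0 he; have e20 : 0 < e ^+ 2 by rewrite exprn_gt0.
have sfg := square_integrable_subv sf sg.
have mdist : measurable_fun setT (fun w => sqnorm (subv (f w) (g w))).
  by apply: measurable_dot; exact: sfg.1.
pose dist : {RV P >-> R} := HB.pack (fun w => sqnorm (subv (f w) (g w)))
  (isMeasurableFun.Build _ _ _ _ _ mdist).
have absE w : `|(dist w)%:E|%E = (sqnorm (subv (f w) (g w)))%:E.
  by rewrite gee0_abs// lee_fin sqnorm_ge0.
pose far := [set w | ((e ^+ 2)%:E <= `|(dist w)%:E|)%E].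
have farE w : far w = (e ^+ 2 <= sqnorm (subv (f w) (g w))).
  by rewrite -lee_fin -absE.
have mfar : measurable far.
  rewrite (_ : far = (fun w => sqnorm (subv (f w) (g w))) @^-1` `[e ^+ 2, +oo[).
    rewrite -[X in measurable X]setTI.
    exact: (mdist measurableT _ (measurable_itv _)).
  by apply/seteqP; split=> w /=; rewrite farE in_itv /= andbT.
have mpre (h : T -> Rd R d) C :
    measurable_fun setT h -> measurable C -> measurable (h @^-1` C).
  by move=> mh mC; rewrite -[X in measurable X]setTI; exact: mh.
have far_eta : (P far <= eta%:E)%E.
  have := @markov _ _ _ P dist id (e ^+ 2) e20 (@measurable_id _ _ _) (fun _ h => h)
    (fun x y _ _ h => h).
  rewrite -/far => /le_trans /(_ (_ : _ <= (e ^+ 2 * eta)%:E)%E) le_far.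
  rewrite -(@lee_pmul2l _ (e ^+ 2)%:E)// -EFinM; apply: le_far.
  rewrite unlock (eq_integral (fun w => (sqnorm (subv (f w) (g w)))%:E)); last first.
    by move=> w _ /=; rewrite ger0_norm// sqnorm_ge0.
  by rewrite (integral_dotE sfg sfg) lee_fin.
apply: (@le_trans _ _ (P (g @^-1` box s e `|` far))).
  apply: le_measure; rewrite ?inE.
  - by apply: mpre => //; exact: sf.1.
  - by apply: measurableU => //; apply: mpre => //; exact: sg.1.
  move=> w; rewrite box0 /= => fs.
  have [wfar|wnear] := leP (e ^+ 2) (sqnorm (subv (f w) (g w))).
    by right; rewrite farE.
  left; apply/allP => n /(allP fs); apply: code_shift_le => i.
  have : (tnth (g w) i - tnth (f w) i) ^+ 2 < e ^+ 2.
    apply: le_lt_trans wnear; rewrite /sqnorm /dot (bigD1 i)//= !tnth_mktuple.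
    rewrite -expr2 -sqrrN opprB lerDl sumr_ge0// => j _.
    by rewrite -expr2 sqr_ge0.
  rewrite lerBlDr -lerBlDl; set a := _ - _ => ae; rewrite leNgt.
  by apply/negP => ea; move: ae; rewrite ltNge ler_pXn2r ?nnegrE ?ltW// (lt_trans e0).
apply: le_trans (measureU2 _ _ _) _ => //.
  by apply: mpre => //; exact: sg.1.
by rewrite leeD2l.
Qed.

(** Mean-square closeness is symmetric in the two variables, so [box_approx] compares [mu'] with
    [mu] in both directions and [le_box] gives equality on every box. *)
Lemma same_law_of_approx (disp : measure_display) (T : measurableType disp)
    (P : probability T R) (X : T -> Rd R d) (mu mu' : probability (Rd R d) R) :
  square_integrable P X -> same_measure (pushforward P X) mu ->
  (forall eta : R, 0 < eta -> exists X', [/\ square_integrable P X',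
     same_measure (pushforward P X') mu' &
     inner P (fun w => subv (X' w) (X w)) (fun w => subv (X' w) (X w)) <= eta]) ->
  same_measure mu' mu.
Proof.
move=> sX Xmu approx; apply: same_measure_code => s; rewrite -box0.
apply/eqP; rewrite eq_le; apply/andP; split; apply: le_box => e eta e0 eta0.
  have [|X' [sX' X'mu h]] := approx (e ^+ 2 * eta).
    by rewrite mulr_gt0// exprn_gt0.
  by rewrite -Xmu// -X'mu//; exact: box_approx.
have [|X' [sX' X'mu h]] := approx (e ^+ 2 * eta).
  by rewrite mulr_gt0// exprn_gt0.
rewrite -Xmu// -X'mu//; apply: box_approx => //.
apply: le_trans h; rewrite le_eqVlt; apply/orP; left; apply/eqP.
by apply: eq_Rintegral => w _; rewrite -!/(sqnorm _) !sqnorm_subv dotC; ring.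
Qed.

End law_limit.

(** * Linear combinations, midpoints and convexity of the maximum covariance *)

Section combinations.
Context {disp : measure_display} {Omega : measurableType disp} {R : realType}
  {d : nat}.
Variable P : probability Omega R.
Implicit Types (X Y Z : {RV P >-> Rd R d}) (mu nu : probability (Rd R d) R).

Lemma dot_rv_comb L (a : 'I_L -> R) (Y : 'I_L -> {RV P >-> Rd R d}) w x :
  dot (rv_comb a Y w) x = \sum_(l < L) a l * dot (Y l w) x.
Proof.
rewrite /dot; under [RHS]eq_bigr do rewrite mulr_sumr.
rewrite exchange_big /=; apply: eq_bigr => i _.
by rewrite tnth_mktuple mulr_suml; apply: eq_bigr => l _; rewrite mulrA.
Qed.

Lemma in_L2_rv_comb L (a : 'I_L -> R) (Y : 'I_L -> {RV P >-> Rd R d}) :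
  (forall l, in_L2 (Y l)) -> in_L2 (P := P) (rv_comb a Y).
Proof.
move=> sY; have {}sY l : square_integrable P (Y l) by exact/in_L2P.
apply/in_L2P; split=> //=.
rewrite (_ : _ \o _ = fun w => \sum_(l < L) \sum_(k < L)
    ((a l)%:E * ((a k)%:E * (dot (Y k w) (Y l w))%:E))%E)%E; last first.
  apply/funext => w /=; rewrite /sqnorm dot_rv_comb -sumEFin.
  apply: eq_bigr => l _; rewrite dotC dot_rv_comb mulr_sumr -sumEFin.
  by apply: eq_bigr => k _; rewrite !EFinM.
apply: integrable_sum => // l _; apply: integrable_sum => // k _.
do 2 apply: integrableZl => //; exact: integrable_dot.
Qed.

Lemma inner_rv_comb L (a : 'I_L -> R) (Y : 'I_L -> {RV P >-> Rd R d}) X :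
  (forall l, in_L2 (Y l)) -> in_L2 X ->
  inner P (rv_comb a Y) X = \sum_(l < L) a l * inner P (Y l) X.
Proof.
move=> sY /in_L2P sX; apply: inner_sum => //; first exact: dot_rv_comb.
by move=> l; exact/in_L2P.
Qed.

Definition midpoint X Z : Omega -> Rd R d :=
  rv_comb (fun=> 2^-1) (fun i : 'I_2 => if i == ord0 then X else Z).

HB.instance Definition _ X Z := MeasurableFun.on (midpoint X Z).

Lemma in_L2_midpoint X Z : in_L2 X -> in_L2 Z -> in_L2 (P := P) (midpoint X Z).
Proof. by move=> sX sZ; apply: in_L2_rv_comb => i; case: ifP. Qed.

Lemma inner_midpoint X Z Y : in_L2 X -> in_L2 Z -> in_L2 Y ->
  inner P (midpoint X Z) Y = 2^-1 * inner P X Y + 2^-1 * inner P Z Y.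
Proof.
move=> sX sZ sY; rewrite inner_rv_comb//; last by move=> i; case: ifP.
by rewrite !big_ord_recl big_ord0 /= addr0.
Qed.

Lemma inner_subv X Z : in_L2 X -> in_L2 Z ->
  inner P (fun w => subv (X w) (Z w)) (fun w => subv (X w) (Z w)) =
  inner P X X + inner P Z Z - 2 * inner P X Z.
Proof.
move=> /in_L2P sX /in_L2P sZ; rewrite {1}/inner.
under eq_Rintegral => w _ do rewrite [dot _ _]sqnorm_subv.
have i0 := integrable_dot sX sZ.
have i1 : P.-integrable setT (EFin \o (fun w => sqnorm (X w) + sqnorm (Z w))).
  by have := integrableD measurableT sX.2 sZ.2; exact.
have i2 : P.-integrable setT (EFin \o (fun w => 2 * dot (X w) (Z w))).
  by have := integrableZl measurableT 2 i0; exact.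
have [[_ iX] [_ iZ]] := (sX, sZ).
by rewrite RintegralB// RintegralD// RintegralZl.
Qed.

(** Convexity of a supremum of linear functionals: a [Y] nearly optimal for the midpoint is a
    competitor for both [X] and [Z]. *)
Lemma maxcorr_midpoint X Z mu mu' nu : atomless P ->
  has_law X mu -> has_law Z mu' -> in_L2 X -> in_L2 Z -> P2 nu ->
  maxcorr (distribution P (midpoint X Z)) nu <=
  2^-1 * maxcorr mu nu + 2^-1 * maxcorr mu' nu.
Proof.
move=> P_atomless Xmu Zmu sX sZ nu2; apply/ler_addgt0Pr => e e0.
have sm := in_L2_midpoint sX sZ.
have mlaw : has_law (P := P) (midpoint X Z) (distribution P (midpoint X Z)) by [].
have [Y [sY Ynu]] := exists_rv_near_maxcorr P_atomless mlaw sm nu2 e0.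
rewrite inner_midpoint// ltrBlDr => /ltW /le_trans; apply.
rewrite lerD2r lerD// ler_pM2l ?invr_gt0//; exact: inner_le_maxcorr.
Qed.

Lemma optimal_coupling_maxcorr mu nu gamma : P2 mu -> P2 nu ->
  optimal_coupling mu nu gamma -> inner gamma fst snd = maxcorr mu nu.
Proof.
move=> mu2 nu2 [cg opt]; apply/eqP; rewrite eq_le le_maxcorr//=.
apply: ge_sup; first by case: (has_sup_maxcorr mu2 nu2).
move=> _ [gamma' cg' <-]; have := opt _ cg'.
rewrite (transport_costE mu2 nu2 cg) (transport_costE mu2 nu2 cg') lee_fin.
by lra.
Qed.

End combinations.

(** * The extrapolation problem *)

(** The algebra of strong convexity. [xx], [xs], [ss] are inner products of [X] and [Xstar], [xb]
    and [sb] those with [Ybar], and [gx], [gs], [gm] the values of [G] at [X], [Xstar] and their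
    midpoint. The midpoint gains an eighth of the squared distance on the average of the endpoints,
    whence the factor [4]. *)
Lemma midpoint_gap (R : realFieldType) (t xx xs ss xb sb gx gs gm : R) :
  1 < t -> gm <= 2^-1 * gx + 2^-1 * gs ->
  2^-1 * ss - t * sb + (t - 1) * gs <=
    2^-1 * (2^-1 * (2^-1 * xx + 2^-1 * xs) + 2^-1 * (2^-1 * xs + 2^-1 * ss)) -
    t * (2^-1 * xb + 2^-1 * sb) + (t - 1) * gm ->
  xx + ss - 2 * xs <= 4 * ((2^-1 * xx - t * xb + (t - 1) * gx) -
                           (2^-1 * ss - t * sb + (t - 1) * gs)).
Proof.
move=> t1 gmle h.
have h' : (t - 1) * gm <= (t - 1) * (2^-1 * gx + 2^-1 * gs).
  by rewrite ler_wpM2l// subr_ge0 ltW.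
by nra.
Qed.

Section extrapolation.
Context (R : realType) (disp : measure_display) (Omega : measurableType disp)
  (P : probability Omega R) (d K L : nat).
Hypothesis P_atomless : atomless P.
Variables (t : R) (lam0 : 'I_K -> R) (lam1 : 'I_L -> R).
Hypotheses (t_gt1 : 1 < t) (lam0_gt0 : forall k, 0 < lam0 k)
  (lam1_gt0 : forall l, 0 < lam1 l) (lam0_sum : \sum_(k < K) lam0 k = 1).
Variables (nu0 : 'I_K -> probability (Rd R d) R)
  (nu1 : 'I_L -> probability (Rd R d) R).
Hypotheses (nu0_P2 : forall k, P2 (nu0 k)) (nu1_P2 : forall l, P2 (nu1 l)).
Variables (Xstar : {RV P >-> Rd R d}) (mu : probability (Rd R d) R).
Hypotheses (Xstar_law : has_law Xstar mu)
  (Xstar_min : minimizer [set X | in_L2 X]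
     (L2_objective t lam0 lam1 nu0 nu1) Xstar).
Variable Y : 'I_L -> {RV P >-> Rd R d}.
Hypotheses (Y_L2 : forall l, in_L2 (Y l))
  (Y_law : forall l, has_law (Y l) (nu1 l))
  (Y_opt : forall l, optimal_coupling mu (nu1 l)
     (distribution P (rv_pair Xstar (Y l)))).

Let Ybar : {RV P >-> Rd R d} := rv_comb lam1 Y.
Let nubar : probability (Rd R d) R := distribution P (rv_comb lam1 Y).

Let sXstar : in_L2 Xstar := Xstar_min.1.
Let mu_P2 : P2 mu := P2_law Xstar_law sXstar.

Let sYbar : in_L2 Ybar.
Proof. exact: in_L2_rv_comb. Qed.

Let Ybar_law : has_law Ybar nubar.
Proof. by []. Qed.

Let nubar_P2 : P2 nubar := P2_law Ybar_law sYbar.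

Let G (m : probability (Rd R d) R) : R := \sum_(k < K) lam0 k * maxcorr m (nu0 k).

(* The [L2_objective] with each [maxcov (nu1 l)] replaced by its supporting
   linear functional at [Xstar]. *)
Let J (X : {RV P >-> Rd R d}) (m : probability (Rd R d) R) : R :=
  2^-1 * inner P X X - t * inner P X Ybar + (t - 1) * G m.

Let inner_Ybar (X : {RV P >-> Rd R d}) : in_L2 X ->
  inner P X Ybar = \sum_(l < L) lam1 l * inner P X (Y l).
Proof.
move=> sX; rewrite innerC inner_rv_comb//.
by apply: eq_bigr => l _; rewrite innerC.
Qed.

Let L2_objectiveE (X : {RV P >-> Rd R d}) m : has_law X m -> in_L2 X ->
  L2_objective t lam0 lam1 nu0 nu1 X = (2^-1 * inner P X X -
    t * (\sum_(l < L) lam1 l * maxcorr m (nu1 l)) + (t - 1) * G m)%:E.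
Proof.
move=> Xm sX; rewrite /L2_objective expectation_sqnorm//.
under eq_bigr do rewrite (maxcov_maxcorr P_atomless Xm sX (nu1_P2 _)) -EFinM.
under [X in (_ + _ * X)%E]eq_bigr do
  rewrite (maxcov_maxcorr P_atomless Xm sX (nu0_P2 _)) -EFinM.
by rewrite !sumEFin -!EFinM -EFinB -EFinD.
Qed.

Let J_min (X : {RV P >-> Rd R d}) m : has_law X m -> in_L2 X ->
  J Xstar mu <= J X m.
Proof.
move=> Xm sX; have := Xstar_min.2 X sX.
rewrite (L2_objectiveE Xstar_law sXstar) (L2_objectiveE Xm sX) lee_fin /J.
rewrite !inner_Ybar// => h.
(* At [Xstar] the couplings with the [Y l] are optimal, so the linear functionals attain the maximum
   covariances; for a general [X] they only lie below, and the coefficient [- t] reverses the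
   inequality. *)
have -> : \sum_(l < L) lam1 l * inner P Xstar (Y l) =
    \sum_(l < L) lam1 l * maxcorr mu (nu1 l).
  apply: eq_bigr => l _; congr (_ * _).
  by rewrite -(optimal_coupling_maxcorr mu_P2 (nu1_P2 l) (Y_opt l)) inner_pair.
apply: (le_trans h); rewrite lerD2r lerD2l lerN2 ler_wpM2l//.
  exact/ltW/(lt_trans ltr01).
apply: ler_sum => l _; rewrite ler_wpM2l//; first exact: ltW.
exact: inner_le_maxcorr.
Qed.

Let objective_cst : R := t * (2^-1 * moment2 nubar) -
  (t - 1) * \sum_(k < K) lam0 k * (2^-1 * moment2 (nu0 k)).

(** The infimum of [J X m] over the [X] of law [m]: a lower bound by [inner_le_maxcorr], approached
    by [near_J]. *)
Let Jbar (m : probability (Rd R d) R) : R :=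
  2^-1 * moment2 m - t * maxcorr m nubar + (t - 1) * G m.

(** By [W2_sqr], and since the [lam0 k] sum to [1], the second moment of [m] gets the coefficient
    [(t - (t - 1)) / 2 = 1 / 2]. The moments of the fixed measures form the constant. *)
Let extrapolation_objectiveE m : P2 m ->
  extrapolation_objective t lam0 nu0 nubar m = (Jbar m + objective_cst)%:E.
Proof.
move=> m2; rewrite /extrapolation_objective W2_sqr//.
under eq_bigr do rewrite W2_sqr// -!EFinM.
rewrite sumEFin -!EFinM -EFinB; congr EFin.
rewrite (_ : \sum_(k < K) _ = 2^-1 * moment2 m +
    \sum_(k < K) lam0 k * (2^-1 * moment2 (nu0 k)) - G m).
  by rewrite /Jbar /objective_cst; field.
rewrite (_ : 2^-1 * moment2 m = \sum_(k < K) lam0 k * (2^-1 * moment2 m)); last first.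
  by rewrite -mulr_suml lam0_sum mul1r.
rewrite /G -sumrN.
rewrite -!big_split /=; apply: eq_bigr => k _ /=; by field.
Qed.

Let near_J m (e : R) : P2 m -> 0 < e ->
  exists X, [/\ in_L2 X, has_law X m & J X m <= Jbar m + t * e].
Proof.
move=> m2 e0.
(* Here [Ybar] is the given variable and [X] the one constructed, so the maximum covariance appears
   with its arguments exchanged. *)
have [X [sX Xm hX]] := exists_rv_near_maxcorr P_atomless Ybar_law sYbar m2 e0.
exists X; split=> //; rewrite /J /Jbar (in_L2_law Xm m2).2.
rewrite [leRHS]addrAC lerD2r -addrA lerD2l addrC -lerN2 opprB opprK -mulrBr.
rewrite ler_wpM2l//; first exact/ltW/(lt_trans ltr01).
by rewrite maxcorrC// innerC ltW.
Qed.

Let Jbar_ge m : P2 m -> J Xstar mu <= Jbar m.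
Proof.
move=> m2; apply/ler_addgt0Pr => e e0.
have t0 : 0 < t by exact: lt_trans t_gt1.
have [|X [sX Xm hX]] := @near_J m (e / t) m2; first by rewrite divr_gt0.
apply: (le_trans (J_min Xm sX)); apply: (le_trans hX).
by rewrite mulrC divfK// gt_eqF.
Qed.

(** [Xstar] and [Ybar] provide one coupling of [mu] and [nubar], whose covariance is at most the
    maximal one. *)
Let Jbar_mu_le : Jbar mu <= J Xstar mu.
Proof.
rewrite /J /Jbar (in_L2_law Xstar_law mu_P2).2 lerD2r lerD2l lerN2.
rewrite ler_wpM2l//; first exact/ltW/(lt_trans ltr01).
exact: inner_le_maxcorr.
Qed.

Lemma minimizer_extrapolation :
  minimizer P2 (extrapolation_objective t lam0 nu0 nubar) mu.
Proof.
split=> [|m m2]; first exact: mu_P2.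
rewrite !extrapolation_objectiveE// lee_fin lerD2r.
exact: le_trans Jbar_mu_le (Jbar_ge m2).
Qed.

(** [J] at the midpoint of [X] and [Xstar] is at least its minimum. The quadratic part yields the
    squared distance, and [G] is convex with the positive weight [t - 1]. *)
Let J_midpoint (X : {RV P >-> Rd R d}) m : has_law X m -> in_L2 X ->
  inner P (fun w => subv (X w) (Xstar w)) (fun w => subv (X w) (Xstar w)) <=
  4 * (J X m - J Xstar mu).
Proof.
move=> Xm sX; have sm := in_L2_midpoint sX sXstar.
have mlaw : has_law (P := P) (midpoint X Xstar) (distribution P (midpoint X Xstar)) by [].
have hJ := J_min mlaw sm.
have hG : G (distribution P (midpoint X Xstar)) <= 2^-1 * G m + 2^-1 * G mu.
  rewrite /G !mulr_sumr -big_split; apply: ler_sum => k _ /=.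
  rewrite !(mulrCA 2^-1) -mulrDr ler_wpM2l//; first exact: ltW.
  exact: maxcorr_midpoint.
rewrite inner_subv//; apply: midpoint_gap t_gt1 hG _.
move: hJ; rewrite /J (inner_midpoint sX sXstar sm) (inner_midpoint sX sXstar sYbar).
rewrite (innerC P X (midpoint X Xstar)) (inner_midpoint sX sXstar sX).
rewrite (innerC P Xstar (midpoint X Xstar)) (inner_midpoint sX sXstar sXstar).
by rewrite (innerC P Xstar X).
Qed.

Lemma minimizer_extrapolation_unique m :
  minimizer P2 (extrapolation_objective t lam0 nu0 nubar) m -> same_measure m mu.
Proof.
move=> [m2 /(_ mu mu_P2)]; rewrite !extrapolation_objectiveE// lee_fin lerD2r => m_le.
have t0 : 0 < t by exact: lt_trans t_gt1.
apply: (same_law_of_approx (X := Xstar) (P := P)); first exact/in_L2P.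
  exact: Xstar_law.
move=> eta eta0.
(* [near_J] loses [t] times its tolerance and [J_midpoint] multiplies the excess by [4], so the
   squared distance is at most [eta]. *)
have [|X [sX Xm hX]] := @near_J m (eta / (4 * t)) m2.
  by rewrite divr_gt0// mulr_gt0.
exists X; split; [exact/in_L2P|exact: Xm|].
apply: (le_trans (J_midpoint Xm sX)).
rewrite -ler_pdivlMl// lerBlDl (le_trans hX)//.
rewrite lerD ?(le_trans m_le)//.
rewrite le_eqVlt; apply/orP; left; apply/eqP.
by field; rewrite gt_eqF.
Qed.

End extrapolation.

Theorem proposition5p3 (R : realType) (disp : measure_display)
    (Omega : measurableType disp) (P : probability Omega R)
    (P_atomless : atomless P) (P_separable : separable P)
    (d K L : nat) (K_ge1 : (1 <= K)%N) (L_ge1 : (1 <= L)%N)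
    (t : R) (t_gt1 : 1 < t)
    (lam0 : 'I_K -> R) (lam1 : 'I_L -> R)
    (lam0_gt0 : forall k, 0 < lam0 k) (lam1_gt0 : forall l, 0 < lam1 l)
    (lam0_sum : \sum_(k < K) lam0 k = 1) (lam1_sum : \sum_(l < L) lam1 l = 1)
    (nu0 : 'I_K -> probability (Rd R d) R)
    (nu1 : 'I_L -> probability (Rd R d) R)
    (nu0_P2 : forall k, P2 (nu0 k)) (nu1_P2 : forall l, P2 (nu1 l))
    (Xstar : {RV P >-> Rd R d}) (mu : probability (Rd R d) R)
    (Xstar_law : has_law Xstar mu)
    (Xstar_min : minimizer [set X | in_L2 X]
                   (L2_objective t lam0 lam1 nu0 nu1) Xstar) :
  forall Y : 'I_L -> {RV P >-> Rd R d},
    (forall l, in_L2 (Y l)) ->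
    (forall l, has_law (Y l) (nu1 l)) ->
    (forall l, optimal_coupling mu (nu1 l)
                 (distribution P (rv_pair Xstar (Y l)))) ->
    let nu1bar := distribution P (rv_comb lam1 Y) in
    minimizer P2 (extrapolation_objective t lam0 nu0 nu1bar) mu /\
    (forall mu' : probability (Rd R d) R,
       minimizer P2 (extrapolation_objective t lam0 nu0 nu1bar) mu' ->
       same_measure mu' mu).
Proof.
move=> Y Y_L2 Y_law Y_opt nu1bar; split.
  exact: (minimizer_extrapolation P_atomless t_gt1 lam1_gt0 lam0_sum
    nu0_P2 nu1_P2 Xstar_law Xstar_min Y_L2 Y_law Y_opt).
exact: (minimizer_extrapolation_unique P_atomless t_gt1 lam0_gt0 lam1_gt0
  lam0_sum nu0_P2 nu1_P2 Xstar_law Xstar_min Y_L2 Y_law Y_opt).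
Qed.
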